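(* Let $A$ be a finite dimensional Frobenius algebra over a field $k$, let $M,N$ be $A$-bimodules and $r,s\in\mathbb Z$. Denote by $\smile,\frown$ the cup and cap products on Hochschild (co)homology $\mathrm H^*,\mathrm H_*$, and by $\widehat\smile,\widehat\frown$ the cup and cap products on Tate-Hochschild (co)homology $\widehat{\mathrm H}^*,\widehat{\mathrm H}_*$. Let $\iota^n:\mathrm H^n(A,X)\to\widehat{\mathrm H}^n(A,X)$ and, for $n\ge0$, $\kappa_n:\widehat{\mathrm H}_n(A,X)\to\mathrm H_n(A,X)$ be the canonical maps. (1) $\iota^{r+s}(u\smile v)=\iota^r(u)\,\widehat\smile\,\iota^s(v)$ for all $u\in\mathrm H^r(A,M)$, $v\in\mathrm H^s(A,N)$. (2) (a) If $r=s=0$: the Hochschild cap product restricts to a map $\mathrm H^0(A,M)\otimes\widehat{\mathrm H}_0(A,N)\to\widehat{\mathrm H}_0(A,M\otimes_AN)$ (where $\widehat{\mathrm H}_0$ is regarded as a subspace of $\mathrm H_0$ via the injection $\kappa_0$), and $u\frown z=\iota^0(u)\,\widehat\frown\,z$ for all $u\in\mathrm H^0(A,M)$, $z\in\widehat{\mathrm H}_0(A,N)$. (b) If $r=0$, $s>0$: identifying $\widehat{\mathrm H}_s=\mathrm H_s$ via $\kappa_s$, one has $u\frown z=\iota^0(u)\,\widehat\frown\,z$ for all $u\in\mathrm H^0(A,M)$, $z\in\mathrm H_s(A,N)$. (c) If $r>0$, $s>0$ and $s\ge r$: identifying $\mathrm H^r=\widehat{\mathrm H}^r$ via $\iota^r$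 and $\widehat{\mathrm H}_s=\mathrm H_s$ via $\kappa_s$, one has $u\frown z=\kappa_{s-r}(u\,\widehat\frown\,z)$ for all $u\in\mathrm H^r(A,M)$, $z\in\mathrm H_s(A,N)$.
   Context: A finite dimensional $k$-algebra $A$ is Frobenius if there is a non-degenerate bilinear form $\langle-,-\rangle:A\otimes_kA\to k$ with $\langle ab,c\rangle=\langle a,bc\rangle$. $A^{\mathrm e}=A\otimes_kA^{\mathrm{op}}$; bimodules are left, or right, $A^{\mathrm e}$-modules as usual. A complete resolution $\mathbf T\xrightarrow{\varepsilon}A$ is an acyclic chain complex $\mathbf T=(T_i,d_i)_{i\in\mathbb Z}$ of finitely generated projective $A$-bimodules together with a factorization $d_0=\eta\varepsilon$, $\varepsilon:T_0\to A$ surjective, $\eta:A\to T_{-1}$ injective; $\varepsilon$, extended by $0$, is the augmentation. $\widehat{\mathrm H}^n(A,X)=\mathrm H^n(\mathrm{Hom}_{A^{\mathrm e}}(\mathbf T,X))$ (cochains $T_n\to X$, differential $f\mapsto-(-1)^nfd_{n+1}$) and $\widehat{\mathrm H}_n(A,X)=\mathrm H_n(\mathbf T\otimes_{A^{\mathrm e}}X)$. The truncation $\mathbf P=\mathbf T_{\ge0}\xrightarrow{\varepsilon}A$ is a projective resolution, and $\mathrm H^n(A,X)=\mathrm H^n(\mathrm{Hom}_{A^{\mathrm e}}(\mathbf P,X))$, $\mathrm H_n(A,X)=\mathrm H_n(\mathbf P\otimes_{A^{\mathrm e}}X)$ (zero for $n<0$). The canonical chain map $\vartheta:\mathbf T\to\mathbf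 P$ (identity in degrees $\ge0$, zero in negative degrees) induces $\iota^n$ and $\kappa_n$. The map $\iota^n$ is an isomorphism for $n>0$ and surjective for $n=0$; $\kappa_n$ is an isomorphism for $n>0$ and injective for $n=0$. Products. $\mathbf T\widehat\otimes_A\mathbf T$ has components $\prod_{i\in\mathbb Z}T_{n-i}\otimes_AT_i$ and differential $x\otimes y\mapsto d(x)\otimes y+(-1)^{|x|}x\otimes d(y)$. A diagonal approximation is a chain map of bimodule complexes $\widehat\Delta:\mathbf T\to\mathbf T\widehat\otimes_A\mathbf T$ with $(\varepsilon\widehat\otimes_A\varepsilon)\widehat\Delta=\varepsilon$ (it exists). For $u:T_r\to M$, $v:T_s\to N$, the cochain $u\,\widehat\smile\,v:T_{r+s}\to M\otimes_AN$ is the component of $\widehat\Delta$ in $T_r\otimes_AT_s$ followed by $x\otimes y\mapsto(-1)^{rs}u(x)\otimes v(y)$. For $u:T_r\to M$ and $a\otimes n\in T_s\otimes_{A^{\mathrm e}}N$, with $\sum x\otimes y$ the component of $\widehat\Delta(a)$ in $T_{s-r}\otimes_AT_r$, $u\,\widehat\frown\,(a\otimes n)=\sum(-1)^{r(s-r)}x\otimes_{A^{\mathrm e}}(u(y)\otimes_An)$. These induce $\widehat\smile:\widehat{\mathrm H}^r(A,M)\otimes\widehat{\mathrm H}^s(A,N)\to\widehat{\mathrm H}^{r+s}(A,M\otimes_AN)$ and $\widehat\frown:\widehat{\mathrm H}^r(A,M)\otimes\widehat{\mathrm H}_s(A,N)\to\widehat{\mathrm H}_{s-r}(A,M\otimes_AN)$.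 The Hochschild products $\smile,\frown$ are defined by the same formulas with $\mathbf P$ in place of $\mathbf T$ and an augmentation-preserving bimodule chain map $\Delta:\mathbf P\to\mathbf P\otimes_A\mathbf P$ in place of $\widehat\Delta$. All these products are independent of choices. *)

(* Defs.v *)
From HB Require Import structures.
From mathcomp Require Import all_boot all_order all_algebra all_field.
From mathcomp Require Import boolp functions.
From mathcomp Require Import freeg.

Set Implicit Arguments.
Unset Strict Implicit.
Unset Printing Implicit Defensive.

Import GRing.Theory Num.Theory.
Local Open Scope ring_scope.
Local Open Scope quotient_scope.

Section LinearFun.
Variables (k : fieldType) (U V : lmodType k) (f : U -> V).
Hypothesis lf : linear f.

Lemma lin0 : f 0 = 0.
Proof. by have := lf (-1) 0 0; rewrite scaler0 add0r scaleN1r addNr. Qed.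
Lemma linD x y : f (x + y) = f x + f y.
Proof. by rewrite -[x in LHS]scale1r lf scale1r. Qed.
Lemma linZ c x : f (c *: x) = c *: f x.
Proof. by rewrite -[c *: x]addr0 lf lin0 addr0. Qed.

End LinearFun.

Section QuotMod.
Variables (k : fieldType) (V : lmodType k).

Inductive lspan (S : V -> Prop) : V -> Prop :=
| LSpan0 : lspan S 0
| LSpanP c s x : S s -> lspan S x -> lspan S (c *: s + x).

Lemma lspan_gen (S : V -> Prop) s : S s -> lspan S s.
Proof.
by move=> Ss; have := LSpanP 1 Ss (LSpan0 S); rewrite scale1r addr0.
Qed.

Definition lspan_pred (S : V -> Prop) : {pred V} := fun x => `[< lspan S x >].

Variable S : V -> Prop.

Lemma lspan_pred_closed : submod_closed (lspan_pred S).
Proof.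
split=> [|c x y]; first by apply/asboolP/LSpan0.
move=> /asboolP Sx /asboolP Sy; apply/asboolP.
elim: Sx => [|d s z Ss _ IH]; first by rewrite scaler0 add0r.
by rewrite scalerDr scalerA -addrA; apply: LSpanP.
Qed.

HB.instance Definition _ :=
  GRing.isSubmodClosed.Build k V (lspan_pred S) lspan_pred_closed.

Definition quotmod := Quotient.quot (lspan_pred S).
HB.instance Definition _ := GRing.Zmodule.on quotmod.
HB.instance Definition _ := EqQuotient.on quotmod.

Definition qproj (x : V) : quotmod := \pi_quotmod x.

Lemma qproj_eqP x y : (qproj x = qproj y) <-> lspan S (x - y).
Proof.
rewrite /qproj; split.
  by move=> /eqP; rewrite -[_ == _]Quotient.idealrBE => /asboolP.
by move=> H; apply/eqP; rewrite -[_ == _]Quotient.idealrBE; apply/asboolP.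
Qed.

Lemma qproj_repr (x : quotmod) : qproj (repr x) = x.
Proof. exact: reprK. Qed.

Lemma qprojD x y : qproj (x + y) = qproj x + qproj y.
Proof. by rewrite /qproj !piE. Qed.

Definition qscale (c : k) (x : quotmod) : quotmod := qproj (c *: repr x).

Lemma qprojZ_subproof c x : qscale c (qproj x) = qproj (c *: x).
Proof.
apply/qproj_eqP; rewrite -scalerBr.
have: lspan S (repr (qproj x) - x) by apply/qproj_eqP/qproj_repr.
move=> H; apply/asboolP; rewrite -[_ *: _]addr0.
by apply: lspan_pred_closed.2; apply/asboolP => //; apply: LSpan0.
Qed.

Lemma quotmod_ind (P : quotmod -> Prop) : (forall x, P (qproj x)) -> forall x, P x.
Proof. by move=> H x; rewrite -[x]qproj_repr. Qed.

Fact qscaleA a b v : qscale a (qscale b v) = qscale (a * b) v.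
Proof. by elim/quotmod_ind: v => x; rewrite !qprojZ_subproof scalerA. Qed.
Fact qscale1 : left_id 1 qscale.
Proof. by elim/quotmod_ind=> x; rewrite qprojZ_subproof scale1r. Qed.
Fact qscaleDr : right_distributive qscale +%R.
Proof.
move=> c; elim/quotmod_ind=> x; elim/quotmod_ind=> y.
by rewrite -qprojD !qprojZ_subproof scalerDr qprojD.
Qed.
Fact qscaleDl v : {morph qscale^~ v : a b / a + b}.
Proof.
by move=> a b; elim/quotmod_ind: v => x; rewrite !qprojZ_subproof scalerDl qprojD.
Qed.

HB.instance Definition _ := GRing.Zmodule_isLmodule.Build k quotmod
  qscaleA qscale1 qscaleDr qscaleDl.

Lemma qproj_is_linear : linear qproj.
Proof. by move=> c x y; rewrite qprojD -qprojZ_subproof. Qed.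
HB.instance Definition _ := GRing.isLinear.Build k V quotmod _ qproj
  qproj_is_linear.

Lemma qproj0P x : qproj x = 0 <-> lspan S x.
Proof. by rewrite -[0](linear0 qproj) qproj_eqP subr0. Qed.

End QuotMod.

(** [tensor ra la] is the quotient of the tensor product of [M] and [N] over
    [k] by the relations [ra m r (x) n = m (x) la r n], for [r] in an arbitrary
    type [R] of scalars acting on the right of [M] and on the left of [N]. *)
Section Tensor.
Variables (k : fieldType) (M N : lmodType k) (R : Type).
Variables (ra : M -> R -> M) (la : R -> N -> N).

Local Notation free := {freeg (M * N)%type / k}.
Local Notation "<| m , n |>" := (<< (m, n) >> : free).

Inductive tensor_rel : free -> Prop :=
| TRelDl m m' n : tensor_rel (<| m + m', n |> - <| m, n |> - <| m', n |>)
| TRelDr m n n' : tensor_rel (<| m, n + n' |> - <| m, n |> - <| m, n' |>)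
| TRelZl c m n : tensor_rel (<| c *: m, n |> - c *: <| m, n |>)
| TRelZr c m n : tensor_rel (<| m, c *: n |> - c *: <| m, n |>)
| TRelA m r n : tensor_rel (<| ra m r, n |> - <| m, la r n |>).

Definition tensor := quotmod tensor_rel.
HB.instance Definition _ := GRing.Lmodule.on tensor.

Definition tens (m : M) (n : N) : tensor := qproj tensor_rel <| m, n |>.

Lemma tens_linl n : linear (tens^~ n).
Proof.
move=> c x y; rewrite /tens.
have -> : c *: qproj tensor_rel <| x, n |> + qproj tensor_rel <| y, n |> =
  qproj tensor_rel (c *: <| x, n |> + <| y, n |>) by rewrite linearP.
apply/qproj_eqP.
have -> : <| c *: x + y, n |> - (c *: <| x, n |> + <| y, n |>) =
   1 *: (<| c *: x + y, n |> - <| c *: x, n |> - <| y, n |>) +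
   (<| c *: x, n |> - c *: <| x, n |>).
  by rewrite scale1r addrACA addrA addrNK addrAC opprD addrA addrAC.
by apply: LSpanP (TRelDl _ _ _) _; apply/lspan_gen/TRelZl.
Qed.

Lemma tens_linr m : linear (tens m).
Proof.
move=> c x y; rewrite /tens.
have -> : c *: qproj tensor_rel <| m, x |> + qproj tensor_rel <| m, y |> =
  qproj tensor_rel (c *: <| m, x |> + <| m, y |>) by rewrite linearP.
apply/qproj_eqP.
have -> : <| m, c *: x + y |> - (c *: <| m, x |> + <| m, y |>) =
   1 *: (<| m, c *: x + y |> - <| m, c *: x |> - <| m, y |>) +
   (<| m, c *: x |> - c *: <| m, x |>).
  by rewrite scale1r addrACA addrA addrNK addrAC opprD addrA addrAC.
by apply: LSpanP (TRelDr _ _ _) _; apply/lspan_gen/TRelZr.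
Qed.

Lemma tens_bal m r n : tens (ra m r) n = tens m (la r n).
Proof. by apply/qproj_eqP/lspan_gen/TRelA. Qed.

Section Lift.
Variables (Z : lmodType k).

Definition balanced (f : M -> N -> Z) : Prop :=
  [/\ forall n, linear (f^~ n), forall m, linear (f m) &
      forall m r n, f (ra m r) n = f m (la r n)].

(** Computed on a representative in the free module: meaningful only for
    balanced [f], see [tliftE] and [tlift_linear]. *)
Definition tlift (f : M -> N -> Z) (t : tensor) : Z :=
  fglift (fun p => f p.1 p.2) (repr t).

Variable f : M -> N -> Z.
Hypothesis bf : balanced f.

Let F : free -> Z := fglift (fun p => f p.1 p.2).

Let F_additive : {morph F : x y / x - y}.
Proof. exact: lift_is_additive. Qed.

Let FB := F_additive.
Let F0 : F 0 = 0. Proof. by rewrite -(subrr 0) FB subrr. Qed.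
Let FD x y : F (x + y) = F x + F y.
Proof. by rewrite -[y in LHS]opprK -(sub0r y) !FB F0 sub0r opprK. Qed.
Let F_sum (s : seq (M * N)) (G : M * N -> free) :
  F (\sum_(i <- s) G i) = \sum_(i <- s) F (G i).
Proof.
by elim: s => [|a s IH]; rewrite ?big_nil ?F0 // !big_cons FD IH.
Qed.

Let FZ c x : F (c *: x) = c *: F x.
Proof.
rewrite {1}/GRing.scale /= /fgscale F_sum -[x in RHS]freeg_sumE F_sum scaler_sumr.
by apply: eq_bigr => z _; rewrite /F !liftU scalerA.
Qed.

Let FU m n : F <| m, n |> = f m n.
Proof. by rewrite /F liftU scale1r. Qed.

Let F_rel x : lspan tensor_rel x -> F x = 0.
Proof.
have [bl br ba] := bf.
elim=> [|c s y Rs _ IH]; first exact: F0.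
rewrite FD FZ IH addr0.
case: Rs => [m m' n|m n n'|d m n|d m n|m r n]; rewrite !FB ?FZ !FU.
- by rewrite (linD (bl n)) addrAC addrK subrr scaler0.
- by rewrite (linD (br m)) addrAC addrK subrr scaler0.
- by rewrite (linZ (bl n)) subrr scaler0.
- by rewrite (linZ (br m)) subrr scaler0.
- by rewrite ba subrr scaler0.
Qed.

Let tlift_proj x : tlift f (qproj tensor_rel x) = F x.
Proof.
apply/eqP; rewrite -subr_eq0 -[tlift _ _]/(F _) -FB; apply/eqP/F_rel.
by apply/qproj_eqP/qproj_repr.
Qed.

Lemma tliftE m n : tlift f (tens m n) = f m n.
Proof. by rewrite tlift_proj FU. Qed.

Lemma tlift_linear : linear (tlift f).
Proof.
move=> c; elim/quotmod_ind=> x; elim/quotmod_ind=> y.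
by rewrite -linearP !tlift_proj FD FZ.
Qed.

End Lift.

Lemma tensor_ind (P : tensor -> Prop) :
  P 0 -> (forall m n x, P x -> P (tens m n + x)) -> forall x, P x.
Proof.
move=> P0 PD; elim/quotmod_ind=> x.
rewrite -[x]freeg_sumE linear_sum /=.
elim: (dom x) => [|[m n] s IH]; first by rewrite big_nil.
rewrite big_cons; set c := coeff _ _.
have -> : << c *g (m, n) >> = c *: <| m, n |>.
  by apply/eqP/freeg_eqP=> z; rewrite coeffZ !coeffU mul1r.
rewrite linearZ /= -[_ *: _]/(c *: tens m n).
by rewrite -(linZ (tens_linl n)); apply: PD.
Qed.

Lemma tensor_ext (Z : lmodType k) (f g : tensor -> Z) : linear f -> linear g ->
  (forall m n, f (tens m n) = g (tens m n)) -> f =1 g.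
Proof.
move=> lf lg E; elim/tensor_ind => [|m n x IH]; first by rewrite !lin0.
by rewrite !linD // E IH.
Qed.

End Tensor.

Arguments tens {k M N R} ra la m n.
Arguments tlift {k M N R ra la Z} f t.

(** Bimodules over a k-algebra; [lact_linl], [ract_linr] and the unit laws say
    that [k] acts centrally, so that these are the modules over the enveloping
    algebra, [(a (x) b) x = a x b] on the left and [x (a (x) b) = b x a] on the
    right. *)
HB.mixin Record Lmodule_isBimodule (k : fieldType) (A : algType k) M
    of GRing.Lmodule k M := {
  lact : A -> M -> M;
  ract : M -> A -> M;
  lact_linl : forall x, linear (lact^~ x);
  lact_linr : forall a, linear (lact a);
  ract_linl : forall a, linear (ract^~ a);
  ract_linr : forall x, linear (ract x);
  lact1 : forall x, lact 1 x = x;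
  ract1 : forall x, ract x 1 = x;
  lactM : forall a b x, lact (a * b) x = lact a (lact b x);
  ractM : forall a b x, ract x (a * b) = ract (ract x a) b;
  lract : forall a b x, ract (lact a x) b = lact a (ract x b)
}.

#[short(type="bimodType")]
HB.structure Definition Bimodule (k : fieldType) (A : algType k) :=
  {M of Lmodule_isBimodule k A M & GRing.Lmodule k M}.

Definition regbimod (k : fieldType) (A : algType k) : Type := A.

Section RegularBimodule.
Variables (k : fieldType) (A : algType k).

HB.instance Definition _ := GRing.Lmodule.on (regbimod A).

Fact reg_linl (x : A) : linear (fun a : A => a * x).
Proof. by move=> c a b; rewrite mulrDl scalerAl. Qed.
Fact reg_linr (a : A) : linear (fun x : A => a * x).
Proof. by move=> c x y; rewrite mulrDr scalerAr. Qed.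
Fact reg_mulA (a b x : A) : a * b * x = a * (b * x).
Proof. by rewrite mulrA. Qed.
Fact reg_mulA' (a b x : A) : x * (a * b) = x * a * b.
Proof. by rewrite mulrA. Qed.

HB.instance Definition _ := @Lmodule_isBimodule.Build k A (regbimod A)
  (fun a x : A => a * x) (fun x a : A => x * a)
  reg_linl reg_linr reg_linl reg_linr (@mul1r A) (@mulr1 A)
  reg_mulA reg_mulA' (fun a b x => esym (mulrA a x b)).

End RegularBimodule.

Section BimodHom.
Variables (k : fieldType) (A : algType k) (M N : bimodType A).

Definition is_bimodhom (f : M -> N) : Prop :=
  [/\ linear f, forall a x, f (lact a x) = lact a (f x) &
      forall x a, f (ract x a) = ract (f x) a].

Definition bimodhom_pred : {pred M -> N} := fun f => `[< is_bimodhom f >].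

Record bimodhom := BimodHom {
  bimodhom_fun :> M -> N;
  _ : bimodhom_fun \in bimodhom_pred
}.

HB.instance Definition _ := [isSub for bimodhom_fun].
HB.instance Definition _ := [Choice of bimodhom by <:].

Fact bimodhom_pred_closed : submod_closed bimodhom_pred.
Proof.
split=> [|c f g].
  apply/asboolP; split=> [d x y|a x|x a].
  - by rewrite -[LHS]/0 -[RHS]/(d *: 0 + 0) scaler0 add0r.
  - by rewrite [RHS](lin0 (lact_linr a)).
  - by rewrite [RHS](lin0 (ract_linl a)).
move=> /asboolP[fl fa fr] /asboolP[gl ga gr]; apply/asboolP.
have E x : (c *: f + g) x = c *: f x + g x by [].
split=> [d x y|a x|x a]; rewrite !E.
- rewrite fl gl !scalerDr !scalerA addrACA; rewrite [c * d]mulrC //.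
- by rewrite fa ga lact_linr.
- by rewrite fr gr ract_linl.
Qed.

HB.instance Definition _ :=
  GRing.isSubmodClosed.Build k _ bimodhom_pred bimodhom_pred_closed.
HB.instance Definition _ := [SubChoice_isSubLmodule of bimodhom by <:].

Lemma bimodhomP (f : bimodhom) : is_bimodhom f.
Proof. by case: f => f /= /asboolP. Qed.

Definition mk_bimodhom (f : M -> N) (hf : is_bimodhom f) : bimodhom :=
  @BimodHom f (asboolT hf).

Lemma bimodhom_linear (f : bimodhom) : linear f.
Proof. by case: (bimodhomP f). Qed.

HB.instance Definition _ (f : bimodhom) :=
  GRing.isLinear.Build k M N _ (bimodhom_fun f) (bimodhom_linear f).

Lemma bimodhom_lact (f : bimodhom) a x : f (lact a x) = lact a (f x).
Proof. by case: (bimodhomP f). Qed.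
Lemma bimodhom_ract (f : bimodhom) x a : f (ract x a) = ract (f x) a.
Proof. by case: (bimodhomP f). Qed.

Lemma bimodhom_eqP (f g : bimodhom) : f =1 g <-> f = g.
Proof. by split=> [E|-> //]; apply/val_inj/funext. Qed.

Lemma bimodhom_addE (f g : bimodhom) x : (f + g) x = f x + g x.
Proof. by []. Qed.
Lemma bimodhom_scaleE c (f : bimodhom) x : (c *: f) x = c *: f x.
Proof. by []. Qed.
Lemma bimodhom_oppE (f : bimodhom) x : (- f) x = - f x.
Proof. by []. Qed.
Lemma bimodhom_zeroE x : (0 : bimodhom) x = 0.
Proof. by []. Qed.

End BimodHom.

Section BimodHomComp.
Variables (k : fieldType) (A : algType k) (L M N : bimodType A).

Fact bimod_id_proof : is_bimodhom (@id M). Proof. by []. Qed.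
Definition bimod_id : bimodhom M M := mk_bimodhom bimod_id_proof.

Fact bimod_comp_proof (g : bimodhom M N) (f : bimodhom L M) :
  is_bimodhom (g \o f).
Proof.
split=> [c x y|a x|x a] /=; first by rewrite !linearP.
- by rewrite !bimodhom_lact.
- by rewrite !bimodhom_ract.
Qed.
Definition bimod_comp g f : bimodhom L N := mk_bimodhom (bimod_comp_proof g f).

End BimodHomComp.

Section TensorA.
Variables (k : fieldType) (A : algType k).

Definition tensorA (M N : bimodType A) := tensor (@ract k A M) (@lact k A N).

Definition tensA (M N : bimodType A) (m : M) (n : N) : tensorA M N :=
  tens (@ract k A M) (@lact k A N) m n.

Section Def.
Variables (M N : bimodType A).

HB.instance Definition _ := GRing.Lmodule.on (tensorA M N).

Definition tensorA_lact (a : A) (t : tensorA M N) : tensorA M N :=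
  tlift (fun m n => tensA (lact a m) n) t.
Definition tensorA_ract (t : tensorA M N) (a : A) : tensorA M N :=
  tlift (fun m n => tensA m (ract n a)) t.

Fact lact_balanced a :
  balanced (@ract k A M) (@lact k A N) (fun m n => tensA (lact a m) n).
Proof.
split=> [n c x y|m|m r n]; last by rewrite -lract [LHS]tens_bal.
- by rewrite lact_linr [LHS]tens_linl.
- exact: tens_linr.
Qed.
Fact ract_balanced a :
  balanced (@ract k A M) (@lact k A N) (fun m n => tensA m (ract n a)).
Proof.
split=> [n|m c x y|m r n]; last by rewrite lract [LHS]tens_bal.
- exact: tens_linl.
- by rewrite ract_linl [LHS]tens_linr.
Qed.

Lemma tensorA_lactE a m n : tensorA_lact a (tensA m n) = tensA (lact a m) n.
Proof. exact: tliftE (lact_balanced a) m n. Qed.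
Lemma tensorA_ractE a m n : tensorA_ract (tensA m n) a = tensA m (ract n a).
Proof. exact: tliftE (ract_balanced a) m n. Qed.

Fact tensorA_lact_linr a : linear (tensorA_lact a).
Proof. exact: tlift_linear (lact_balanced a). Qed.
Fact tensorA_ract_linl a : linear (tensorA_ract^~ a).
Proof. exact: tlift_linear (ract_balanced a). Qed.

Let lr0 a := lin0 (tensorA_lact_linr a).
Let rl0 a := lin0 (tensorA_ract_linl a).
Let lrD a := linD (tensorA_lact_linr a).
Let rlD a := linD (tensorA_ract_linl a).

Fact tensorA_lact_linl x : linear (tensorA_lact^~ x).
Proof.
move=> c a b; elim/tensor_ind: x => [|m n x IH].
  by rewrite !lr0 scaler0 add0r.
rewrite !lrD IH !tensorA_lactE lact_linl [X in X + _]tens_linl.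
by rewrite scalerDr addrACA.
Qed.
Fact tensorA_ract_linr x : linear (tensorA_ract x).
Proof.
move=> c a b; elim/tensor_ind: x => [|m n x IH].
  by rewrite !rl0 scaler0 add0r.
rewrite !rlD IH !tensorA_ractE ract_linr [X in X + _]tens_linr.
by rewrite scalerDr addrACA.
Qed.
Fact tensorA_lact1 x : tensorA_lact 1 x = x.
Proof.
elim/tensor_ind: x => [|m n x IH]; first exact: lr0.
by rewrite lrD IH tensorA_lactE lact1.
Qed.
Fact tensorA_ract1 x : tensorA_ract x 1 = x.
Proof.
elim/tensor_ind: x => [|m n x IH]; first exact: rl0.
by rewrite rlD IH tensorA_ractE ract1.
Qed.
Fact tensorA_lactM a b x :
  tensorA_lact (a * b) x = tensorA_lact a (tensorA_lact b x).
Proof.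
elim/tensor_ind: x => [|m n x IH]; first by rewrite !lr0.
by rewrite !lrD IH !tensorA_lactE lactM.
Qed.
Fact tensorA_ractM a b x :
  tensorA_ract x (a * b) = tensorA_ract (tensorA_ract x a) b.
Proof.
elim/tensor_ind: x => [|m n x IH]; first by rewrite !rl0.
by rewrite !rlD IH !tensorA_ractE ractM.
Qed.
Fact tensorA_lract a b x :
  tensorA_ract (tensorA_lact a x) b = tensorA_lact a (tensorA_ract x b).
Proof.
elim/tensor_ind: x => [|m n x IH]; first by rewrite lr0 rl0 lr0.
by rewrite lrD !rlD lrD IH !(tensorA_lactE, tensorA_ractE).
Qed.

HB.instance Definition _ := @Lmodule_isBimodule.Build k A (tensorA M N)
  tensorA_lact tensorA_ract tensorA_lact_linl tensorA_lact_linr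
  tensorA_ract_linl tensorA_ract_linr tensorA_lact1 tensorA_ract1
  tensorA_lactM tensorA_ractM tensorA_lract.

End Def.

Lemma tensA_lact (M N : bimodType A) a (m : M) (n : N) :
  lact a (tensA m n) = tensA (lact a m) n.
Proof. exact: tensorA_lactE. Qed.
Lemma tensA_ract (M N : bimodType A) (m : M) (n : N) a :
  ract (tensA m n) a = tensA m (ract n a).
Proof. exact: tensorA_ractE. Qed.
Lemma tensA_bal (M N : bimodType A) (m : M) (n : N) a :
  tensA (ract m a) n = tensA m (lact a n).
Proof. exact: tens_bal. Qed.

Lemma tensorA_ext (M N Z : bimodType A) (f g : bimodhom (tensorA M N) Z) :
  (forall m n, f (tensA m n) = g (tensA m n)) -> f =1 g.
Proof.
by move=> E; apply: (tensor_ext (bimodhom_linear f) (bimodhom_linear g)).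
Qed.

Section Map.
Variables (M N M' N' : bimodType A) (f : bimodhom M M') (g : bimodhom N N').

Fact tmap_balanced :
  balanced (@ract k A M) (@lact k A N) (fun m n => tensA (f m) (g n)).
Proof.
split=> [n c x y|m c x y|m r n].
- by rewrite linearP [LHS]tens_linl.
- by rewrite linearP [LHS]tens_linr.
- by rewrite bimodhom_ract bimodhom_lact tensA_bal.
Qed.

Definition tmap_fun (t : tensorA M N) : tensorA M' N' :=
  tlift (fun m n => tensA (f m) (g n)) t.

Fact tmap_funE m n : tmap_fun (tensA m n) = tensA (f m) (g n).
Proof. exact: tliftE tmap_balanced m n. Qed.

Fact tmap_is_bimodhom : is_bimodhom tmap_fun.
Proof.
have lin : linear tmap_fun := tlift_linear tmap_balanced.
split=> //.
- move=> a; elim/tensor_ind => [|m n x IH]; first by rewrite (lin0 (lact_linr a)) !(lin0 lin) (lin0 (lact_linr a)).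
  rewrite (linD (lact_linr a)) !(linD lin) (linD (lact_linr a)) IH; congr (_ + _).
  by rewrite -/(tensA m n) tensA_lact !tmap_funE tensA_lact bimodhom_lact.
- move=> x a; move: x; elim/tensor_ind => [|m n x IH]; first by rewrite (lin0 (ract_linl a)) !(lin0 lin) (lin0 (ract_linl a)).
  rewrite (linD (ract_linl a)) !(linD lin) (linD (ract_linl a)) IH; congr (_ + _).
  by rewrite -/(tensA m n) tensA_ract !tmap_funE tensA_ract bimodhom_ract.
Qed.

Definition tmap : bimodhom (tensorA M N) (tensorA M' N') :=
  mk_bimodhom tmap_is_bimodhom.

Lemma tmapE m n : tmap (tensA m n) = tensA (f m) (g n).
Proof. exact: tmap_funE. Qed.

End Map.

End TensorA.

(** It suffices to balance over the pure tensors [a (x) b], encoded as pairs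
    [(a, b)], since these span [A^e]: the relation is
    [b x a (x) y = x (x) a y b]. *)
Section TensorAe.
Variables (k : fieldType) (A : algType k).

Definition Ae_ract (M : bimodType A) (x : M) (r : A * A) : M :=
  ract (lact r.2 x) r.1.
Definition Ae_lact (N : bimodType A) (r : A * A) (y : N) : N :=
  ract (lact r.1 y) r.2.

Definition tensorAe (M N : bimodType A) := tensor (@Ae_ract M) (@Ae_lact N).
HB.instance Definition _ M N := GRing.Lmodule.on (tensorAe M N).

Definition tensAe (M N : bimodType A) (m : M) (n : N) : tensorAe M N :=
  tens (@Ae_ract M) (@Ae_lact N) m n.

Lemma tensAe_lact (M N : bimodType A) (x : M) (y : N) a :
  tensAe x (lact a y) = tensAe (ract x a) y.
Proof.
have -> : lact a y = Ae_lact (a, 1) y by rewrite /Ae_lact ract1.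
have -> : ract x a = Ae_ract x (a, 1) by rewrite /Ae_ract lact1.
by rewrite /tensAe tens_bal.
Qed.

Lemma tensAe_ract (M N : bimodType A) (x : M) (y : N) b :
  tensAe x (ract y b) = tensAe (lact b x) y.
Proof.
have -> : ract y b = Ae_lact (1, b) y by rewrite /Ae_lact lact1.
have -> : lact b x = Ae_ract x (1, b) by rewrite /Ae_ract ract1.
by rewrite /tensAe tens_bal.
Qed.

Variables (M M' N : bimodType A) (f : bimodhom M M').

Definition tmapAe (t : tensorAe M N) : tensorAe M' N :=
  tlift (fun m n => tensAe (f m) n) t.

Fact tmapAe_balanced :
  balanced (@Ae_ract M) (@Ae_lact N) (fun m n => tensAe (f m) n).
Proof.
split=> [n c x y|m|m r n].
- by rewrite linearP [LHS]tens_linl.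
- exact: tens_linr.
- by rewrite /Ae_ract bimodhom_ract bimodhom_lact -/(Ae_ract _ _) [LHS]tens_bal.
Qed.

Lemma tmapAeE m n : tmapAe (tensAe m n) = tensAe (f m) n.
Proof. exact: tliftE tmapAe_balanced m n. Qed.

Fact tmapAe_linear : linear tmapAe.
Proof. exact: tlift_linear tmapAe_balanced. Qed.
HB.instance Definition _ := GRing.isLinear.Build k _ _ _ tmapAe tmapAe_linear.

End TensorAe.

Definition bimod_prod (k : fieldType) (A : algType k) (I : Type)
  (F : I -> bimodType A) : Type := forall i, F i.

Section BimodProd.
Variables (k : fieldType) (A : algType k) (I : Type) (F : I -> bimodType A).

Local Notation P := (bimod_prod F).
Implicit Types x y z : P.

HB.instance Definition _ := gen_eqMixin P.
HB.instance Definition _ := gen_choiceMixin P.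

Let ext x y : (forall i, x i = y i) -> x = y.
Proof. exact: functional_extensionality_dep. Qed.

Let pzero : P := fun=> 0.
Let popp x : P := fun i => - x i.
Let padd x y : P := fun i => x i + y i.
Let pscale (c : k) x : P := fun i => c *: x i.

Fact paddA : associative padd.
Proof. by move=> x y z; apply: ext => i; apply: addrA. Qed.
Fact paddC : commutative padd.
Proof. by move=> x y; apply: ext => i; apply: addrC. Qed.
Fact padd0 : left_id pzero padd.
Proof. by move=> x; apply: ext => i; apply: add0r. Qed.
Fact paddN : left_inverse pzero popp padd.
Proof. by move=> x; apply: ext => i; apply: addNr. Qed.
HB.instance Definition _ := GRing.isZmodule.Build P paddA paddC padd0 paddN.

Fact pscaleA a b x : pscale a (pscale b x) = pscale (a * b) x.
Proof. by apply: ext => i; apply: scalerA. Qed.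
Fact pscale1 : left_id 1 pscale.
Proof. by move=> x; apply: ext => i; apply: scale1r. Qed.
Fact pscaleDr : right_distributive pscale +%R.
Proof. by move=> c x y; apply: ext => i; apply: scalerDr. Qed.
Fact pscaleDl x : {morph pscale^~ x : a b / a + b}.
Proof. by move=> a b; apply: ext => i; apply: scalerDl. Qed.
HB.instance Definition _ := GRing.Zmodule_isLmodule.Build k P
  pscaleA pscale1 pscaleDr pscaleDl.

Let plact (a : A) x : P := fun i => lact a (x i).
Let pract x (a : A) : P := fun i => ract (x i) a.

Fact plact_linl x : linear (plact^~ x).
Proof. by move=> c a b; apply: ext => i; apply: lact_linl. Qed.
Fact plact_linr a : linear (plact a).
Proof. by move=> c x y; apply: ext => i; apply: lact_linr. Qed.
Fact pract_linl a : linear (pract^~ a).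
Proof. by move=> c x y; apply: ext => i; apply: ract_linl. Qed.
Fact pract_linr x : linear (pract x).
Proof. by move=> c a b; apply: ext => i; apply: ract_linr. Qed.
Fact plact1 x : plact 1 x = x.
Proof. by apply: ext => i; apply: lact1. Qed.
Fact pract1 x : pract x 1 = x.
Proof. by apply: ext => i; apply: ract1. Qed.
Fact plactM a b x : plact (a * b) x = plact a (plact b x).
Proof. by apply: ext => i; apply: lactM. Qed.
Fact practM a b x : pract x (a * b) = pract (pract x a) b.
Proof. by apply: ext => i; apply: ractM. Qed.
Fact plract a b x : pract (plact a x) b = plact a (pract x b).
Proof. by apply: ext => i; apply: lract. Qed.

HB.instance Definition _ := @Lmodule_isBimodule.Build k A P
  plact pract plact_linl plact_linr pract_linl pract_linr plact1 pract1
  plactM practM plract.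

Lemma bimod_prod_ext x y : (forall i, x i = y i) -> x = y.
Proof. exact: ext. Qed.

End BimodProd.

Definition zero_bimod (k : fieldType) (A : algType k) : bimodType A :=
  bimod_prod (fun i : void => regbimod A : bimodType A).

Section Projective.
Variables (k : fieldType) (A : algType k) (P : bimodType A).

Definition fg_bimod : Prop := exists s : seq P, forall x : P,
  exists2 t : seq (A * P * A), {subset [seq u.1.2 | u <- t] <= s} &
    x = \sum_(u <- t) ract (lact u.1.1 u.1.2) u.2.

Definition projective_bimod : Prop :=
  forall (X Y : bimodType A) (p : bimodhom X Y) (f : bimodhom P Y),
    (forall y, exists x, p x = y) ->
  exists g : bimodhom P X, forall x, p (g x) = f x.

End Projective.

(** The differential is given by maps [C i -> C j] for all [i], [j], zero unless
    [i = j + 1]; this avoids transports along equations between degrees. *)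
Record bicomplex (k : fieldType) (A : algType k) := Bicomplex {
  cobj :> int -> bimodType A;
  cdiff : forall i j, bimodhom (cobj i) (cobj j);
  cdiff_out : forall i j x, i <> j + 1 -> cdiff i j x = 0;
  cdiffK : forall i j l x, cdiff j l (cdiff i j x) = 0
}.

Arguments cdiff {k A} b i j.

Record chain_map (k : fieldType) (A : algType k) (C D : bicomplex A) :=
  ChainMap {
  cmap :> forall n, bimodhom (C n) (D n);
  cmap_comm : forall i j x, cmap j (cdiff C i j x) = cdiff D i j (cmap i x)
}.

Section Truncation.
Variables (k : fieldType) (A : algType k) (T : bicomplex A).

Definition trunc_obj (n : int) : bimodType A :=
  match n with Posz m => T (Posz m) | Negz _ => zero_bimod A end.

Definition trunc_diff (i j : int) : bimodhom (trunc_obj i) (trunc_obj j) :=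
  match i, j with
  | Posz m, Posz n => cdiff T (Posz m) (Posz n)
  | _, _ => 0
  end.

Fact trunc_diff_out i j x : i <> j + 1 -> trunc_diff i j x = 0.
Proof. by case: i x => m x; case: j => n //=; apply: cdiff_out. Qed.

Fact trunc_diffK i j l x : trunc_diff j l (trunc_diff i j x) = 0.
Proof.
case: j => j; last by case: i x => m x; case: l => n.
case: i x => m x; case: l => n //=; rewrite ?linear0 //.
exact: cdiffK.
Qed.

Definition trunc : bicomplex A := Bicomplex trunc_diff_out trunc_diffK.

Definition theta_obj (n : int) : bimodhom (T n) (trunc n) :=
  match n with Posz m => bimod_id (T (Posz m)) | Negz _ => 0 end.

Fact theta_comm i j x :
  theta_obj j (cdiff T i j x) = cdiff trunc i j (theta_obj i x).
Proof.
case: j => j; last by case: i x => m x.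
case: i x => m x //=.
apply: cdiff_out => E; move: E; rewrite NegzE.
by case: j.
Qed.

Definition theta : chain_map T trunc := ChainMap theta_comm.

End Truncation.

Section CompleteTensor.
Variables (k : fieldType) (A : algType k) (C D : bicomplex A).

(** Degree [n] is the product of the [C p (x)_A D q] over all [p + q = n].
    If [C] and [D] vanish in negative degrees this is a finite product, and we
    obtain the usual tensor product complex. *)
Definition ctensor_idx (n : int) := {pq : int * int | pq.1 + pq.2 = n}.

Definition ctensor_obj (n : int) : bimodType A :=
  bimod_prod (fun w : ctensor_idx n =>
    tensorA (C (sval w).1) (D (sval w).2) : bimodType A).

(** The component of [x] in [C p (x)_A D q], understood as [0] if
    [p + q <> n]. *)
Definition tcomp n (x : ctensor_obj n) (p q : int) : tensorA (C p) (D q) :=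
  match p + q =P n with
  | ReflectT e => x (exist _ (p, q) e)
  | ReflectF _ => 0
  end.

Lemma tcompE n (x : ctensor_obj n) (w : ctensor_idx n) :
  tcomp x (sval w).1 (sval w).2 = x w.
Proof.
case: w => -[p q] /= e; rewrite /tcomp; case: eqP => // e'.
by rewrite (eq_irrelevance e' e).
Qed.

Lemma tcomp_out n (x : ctensor_obj n) p q : p + q <> n -> tcomp x p q = 0.
Proof. by move=> ne; rewrite /tcomp; case: eqP. Qed.

Fact tcomp_is_bimodhom n p q :
  is_bimodhom (fun x : ctensor_obj n => tcomp x p q).
Proof.
rewrite /tcomp; case: eqP => e; split=> //.
- by move=> c x y; rewrite scaler0 add0r.
- by move=> a x; rewrite (lin0 (lact_linr a)).
- by move=> x a; rewrite (lin0 (ract_linl a)).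
Qed.
Definition tcomp_hom n p q : bimodhom (ctensor_obj n) (tensorA (C p) (D q)) :=
  mk_bimodhom (@tcomp_is_bimodhom n p q).

Definition dleft p p' q : bimodhom (tensorA (C p) (D q)) (tensorA (C p') (D q)) :=
  tmap (cdiff C p p') (bimod_id (D q)).
Definition dright p q q' : bimodhom (tensorA (C p) (D q)) (tensorA (C p) (D q')) :=
  tmap (bimod_id (C p)) (cdiff D q q').

(** [d (x (x) y) = d x (x) y + (-1)^|x| x (x) d y]. If [i <> j + 1], both terms
    are zero. *)
Definition ctensor_diff_fun i j (x : ctensor_obj i) : ctensor_obj j :=
  fun w => let p := (sval w).1 in let q := (sval w).2 in
    dleft (p + 1) p q (tcomp x (p + 1) q)
    + (-1) ^ p *: dright p (q + 1) q (tcomp x p (q + 1)).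

Fact ctensor_diff_is_bimodhom i j : is_bimodhom (@ctensor_diff_fun i j).
Proof.
have H p q p' q' (f : bimodhom (tensorA (C p) (D q)) (tensorA (C p') (D q')))
    c (x y : ctensor_obj i) :
  f (tcomp (c *: x + y) p q) = c *: f (tcomp x p q) + f (tcomp y p q).
  by rewrite -linearP; congr (f _); apply: (bimodhom_linear (tcomp_hom i p q)).
have Hl p q p' q' (f : bimodhom (tensorA (C p) (D q)) (tensorA (C p') (D q')))
    a (x : ctensor_obj i) : f (tcomp (lact a x) p q) = lact a (f (tcomp x p q)).
  by rewrite -bimodhom_lact; congr (f _); apply: (bimodhom_lact (tcomp_hom i p q)).
have Hr p q p' q' (f : bimodhom (tensorA (C p) (D q)) (tensorA (C p') (D q')))
    a (x : ctensor_obj i) : f (tcomp (ract x a) p q) = ract (f (tcomp x p q)) a.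
  by rewrite -bimodhom_ract; congr (f _); apply: (bimodhom_ract (tcomp_hom i p q)).
split=> [c x y|a x|x a]; apply: bimod_prod_ext => w.
- rewrite -[RHS]/(c *: ctensor_diff_fun x w + ctensor_diff_fun y w).
  rewrite /ctensor_diff_fun !H !scalerDr !scalerA [_ * c]mulrC.
  by rewrite -!addrA; congr (_ + _); rewrite addrCA.
- rewrite -[RHS]/(lact a (ctensor_diff_fun x w)) /ctensor_diff_fun !Hl.
  by rewrite -(linZ (lact_linr a)) -(linD (lact_linr a)).
- rewrite -[RHS]/(ract (ctensor_diff_fun x w) a) /ctensor_diff_fun !Hr.
  by rewrite -(linZ (ract_linl a)) -(linD (ract_linl a)).
Qed.

Definition ctensor_diff i j : bimodhom (ctensor_obj i) (ctensor_obj j) :=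
  mk_bimodhom (@ctensor_diff_is_bimodhom i j).

Fact ctensor_diff_out i j x : i <> j + 1 -> ctensor_diff i j x = 0.
Proof.
move=> ne; apply: bimod_prod_ext => -[[p q] /= e].
rewrite -[RHS]/(0 : tensorA (C p) (D q)).
rewrite -[LHS]/(dleft (p + 1) p q (tcomp x (p + 1) q)
  + (-1) ^ p *: dright p (q + 1) q (tcomp x p (q + 1))).
have E1 : p + 1 + q <> i by move=> E; apply: ne; rewrite -E -e addrAC.
have E2 : p + (q + 1) <> i by move=> E; apply: ne; rewrite -E -e addrA.
by rewrite (tcomp_out _ E1) (tcomp_out _ E2) !linear0 addr0.
Qed.

Lemma ctensor_diffE j (x : ctensor_obj (j + 1)) p q :
  tcomp (ctensor_diff (j + 1) j x) p q =
    dleft (p + 1) p q (tcomp x (p + 1) q)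
    + (-1) ^ p *: dright p (q + 1) q (tcomp x p (q + 1)).
Proof.
have [e|ne] := eqVneq (p + q) j.
  exact: (tcompE (ctensor_diff (j + 1) j x) (exist _ (p, q) e)).
have ne' : p + q <> j by apply/eqP.
rewrite !tcomp_out ?linear0 ?scaler0 ?addr0 //.
  by rewrite addrA => /addIr.
by rewrite addrAC => /addIr.
Qed.

Fact ctensor_diffK i j l x : ctensor_diff j l (ctensor_diff i j x) = 0.
Proof.
have [ej|/eqP ne] := eqVneq j (l + 1); last by rewrite ctensor_diff_out.
have [ei|/eqP ne] := eqVneq i (j + 1); last first.
  by rewrite (ctensor_diff_out _ ne) linear0.
subst i j; apply: bimod_prod_ext => w; rewrite -tcompE ctensor_diffE.
rewrite -[RHS]/(0 : tensorA (C (sval w).1) (D (sval w).2)).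
move: (sval w).1 (sval w).2 => p q; rewrite !ctensor_diffE.
rewrite !(linD (bimodhom_linear _)) !(linZ (bimodhom_linear _)).
have LL y : dleft (p + 1) p q (dleft (p + 1 + 1) (p + 1) q y) = 0.
  apply: (tensorA_ext (f := bimod_comp (dleft _ _ _) (dleft _ _ _)) (g := 0)).
  move=> m n; rewrite -[LHS]/(dleft _ _ _ (dleft _ _ _ (tensA m n))).
  by rewrite /dleft !tmapE cdiffK; apply: (lin0 (tens_linl _ _ _)).
have RR y : dright p (q + 1) q (dright p (q + 1 + 1) (q + 1) y) = 0.
  apply: (tensorA_ext (f := bimod_comp (dright _ _ _) (dright _ _ _)) (g := 0)).
  move=> m n; rewrite -[LHS]/(dright _ _ _ (dright _ _ _ (tensA m n))).
  by rewrite /dright !tmapE cdiffK; apply: (lin0 (tens_linr _ _ _)).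
have LR y : dleft (p + 1) p q (dright (p + 1) (q + 1) q y) =
            dright p (q + 1) q (dleft (p + 1) p (q + 1) y).
  apply: (tensorA_ext (f := bimod_comp (dleft _ _ _) (dright _ _ _))
                      (g := bimod_comp (dright _ _ _) (dleft _ _ _))) => m n.
  rewrite -[LHS]/(dleft _ _ _ (dright _ _ _ (tensA m n))).
  rewrite -[RHS]/(dright _ _ _ (dleft _ _ _ (tensA m n))).
  by rewrite /dleft /dright !tmapE.
rewrite LL RR LR !scaler0 addr0 add0r -scalerDl.
by rewrite exprzDr ?unitrN1 // expr1z mulrN1 addNr scale0r.
Qed.

Definition ctensor : bicomplex A := Bicomplex ctensor_diff_out ctensor_diffK.

End CompleteTensor.

Section Homology.
Variables (k : fieldType) (U V W : lmodType k).
Variables (f : {linear U -> V}) (g : {linear V -> W}).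

Definition ker_pred : {pred V} := fun v => g v == 0.

Fact ker_pred_closed : submod_closed ker_pred.
Proof.
split=> [|c x y]; rewrite !unfold_in ?linear0 // => /eqP gx /eqP gy.
by rewrite linearD linearZ /= gx gy scaler0 addr0 eqxx.
Qed.
HB.instance Definition _ :=
  GRing.isSubmodClosed.Build k V ker_pred ker_pred_closed.

Record cycles := Cycle { cycle_val :> V; _ : cycle_val \in ker_pred }.
HB.instance Definition _ := [isSub for cycle_val].
HB.instance Definition _ := [Choice of cycles by <:].
HB.instance Definition _ := [SubChoice_isSubLmodule of cycles by <:].

(** The homology [ker g / im f] at [V]; the definition also makes sense without
    [g \o f = 0], [im f] being then replaced by its intersection with [ker g]. *)
Definition ker_mod_im := quotmod (fun z : cycles => exists u, cycle_val z = f u).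
HB.instance Definition _ := GRing.Lmodule.on ker_mod_im.

(** The class of a cycle. To make this total, non-cycles are sent to [0]. *)
Definition hcls (v : V) : ker_mod_im := qproj _ (insubd (0 : cycles) v).

Definition hrep (c : ker_mod_im) : V := cycle_val (repr c).

Lemma hrepP c : g (hrep c) = 0.
Proof. by rewrite /hrep; case: (repr c) => v /= /eqP. Qed.

Lemma hrepK c : hcls (hrep c) = c.
Proof. by rewrite /hcls /hrep valKd; apply: qproj_repr. Qed.

Lemma hcls_eqP v w : g v = 0 -> g w = 0 ->
  (hcls v = hcls w <-> exists u, v - w = f u).
Proof.
move=> gv gw; rewrite /hcls qproj_eqP.
have E x : g x = 0 -> cycle_val (insubd (0 : cycles) x) = x.
  by move=> gx; apply: insubdK; apply/eqP.
split=> [H|[u E']]; last first.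
  by apply: lspan_gen; exists u; rewrite -E' -[in RHS](E v gv) -[in RHS](E w gw).
have -> : v - w = cycle_val (insubd (0 : cycles) v - insubd (0 : cycles) w).
  by rewrite -[in LHS](E v gv) -[in LHS](E w gw).
elim: H => [|c s x [u us] _ [u' xu']]; first by exists 0; rewrite linear0.
by exists (c *: u + u'); rewrite linearP -us -xu'.
Qed.

Lemma hrep_hcls v : g v = 0 -> exists u, hrep (hcls v) - v = f u.
Proof. by move=> gv; apply/(hcls_eqP (hrepP _) gv); rewrite hrepK. Qed.

End Homology.

Arguments hcls {k U V W} f g v.
Arguments hrep {k U V W f g} c.

Section Coefficients.
Variables (k : fieldType) (A : algType k) (C : bicomplex A) (X : bimodType A).

Definition cobnd i j (f : bimodhom (C i) X) : bimodhom (C j) X :=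
  - ((-1) ^ i *: bimod_comp f (cdiff C j i)).

Fact cobnd_linear i j : linear (@cobnd i j).
Proof.
move=> c f g; apply/bimodhom_eqP => x; rewrite /cobnd.
rewrite !(bimodhom_oppE, bimodhom_addE, bimodhom_scaleE) /=.
by rewrite scalerDr opprD scalerN !scalerA mulrC.
Qed.
HB.instance Definition _ i j := GRing.isLinear.Build k _ _ _ (@cobnd i j)
  (@cobnd_linear i j).

Definition bnd i j (z : tensorAe (C i) X) : tensorAe (C j) X :=
  tmapAe (cdiff C i j) z.
Fact bnd_linear i j : linear (@bnd i j).
Proof. exact: tmapAe_linear. Qed.
HB.instance Definition _ i j := GRing.isLinear.Build k _ _ _ (@bnd i j)
  (@bnd_linear i j).

Definition cohomology (n : int) := ker_mod_im (@cobnd (n - 1) n) (@cobnd n (n + 1)).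

Definition homology (n : int) := ker_mod_im (@bnd (n + 1) n) (@bnd n (n - 1)).

Definition ccls (n : int) : bimodhom (C n) X -> cohomology n :=
  hcls (@cobnd (n - 1) n) (@cobnd n (n + 1)).

Definition hhcls (n : int) : tensorAe (C n) X -> homology n :=
  hcls (@bnd (n + 1) n) (@bnd n (n - 1)).

Lemma cocycleP n (u : bimodhom (C n) X) :
  cobnd (n + 1) u = 0 <-> forall x, u (cdiff C (n + 1) n x) = 0.
Proof.
have sg : (-1) ^ n != 0 :> k by rewrite expfz_neq0 // oppr_eq0 oner_eq0.
rewrite -bimodhom_eqP; split=> [E x|E x]; last first.
  by rewrite /cobnd !(bimodhom_oppE, bimodhom_scaleE) /= E scaler0 oppr0.
have /eqP := E x; rewrite /cobnd !(bimodhom_oppE, bimodhom_scaleE) /=.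
by rewrite oppr_eq0 scaler_eq0 (negPf sg) => /eqP.
Qed.

End Coefficients.

Arguments ccls {k A C X n} u : rename.
Arguments hhcls {k A C X n} z : rename.

(** [C] is either a complete resolution or its truncation, so that these are
    both the Tate-Hochschild and the Hochschild products. *)
Section Products.
Variables (k : fieldType) (A : algType k) (C : bicomplex A).
Variable Delta : chain_map C (ctensor C C).

(** [cup_raw n u v], for [n = r + s], is the cup product without its sign. *)
Definition cup_raw (M N : bimodType A) (n r s : int)
    (u : bimodhom (C r) M) (v : bimodhom (C s) N) :
    bimodhom (C n) (tensorA M N) :=
  bimod_comp (tmap u v) (bimod_comp (tcomp_hom C C n r s) (Delta n)).

Definition cup_cochain (M N : bimodType A) (r s : int)
    (u : bimodhom (C r) M) (v : bimodhom (C s) N) :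
    bimodhom (C (r + s)) (tensorA M N) :=
  (-1) ^ (r * s) *: cup_raw (r + s) u v.

(** [x (x)_A y |-> x (x)_{A^e} (u y (x)_A n)] *)
Definition cap_pair (M N : bimodType A) (p r : int) (u : bimodhom (C r) M)
    (n : N) (t : tensorA (C p) (C r)) : tensorAe (C p) (tensorA M N) :=
  tlift (fun x y => tensAe x (tensA (u y) n : tensorA M N)) t.

(** [cap_raw p u z], for [p = s - r], is the cap product without its sign. *)
Definition cap_raw (M N : bimodType A) (s r p : int) (u : bimodhom (C r) M)
    (z : tensorAe (C s) N) : tensorAe (C p) (tensorA M N) :=
  tlift (fun a n => cap_pair u n (tcomp (Delta s a) p r)) z.

Definition cap_chain (M N : bimodType A) (r s : int) (u : bimodhom (C r) M)
    (z : tensorAe (C s) N) : tensorAe (C (s - r)) (tensorA M N) :=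
  (-1) ^ (r * (s - r)) *: cap_raw (s - r) u z.

(** The induced products are computed on representing cycles; [cup_ccls] and
    [cap_hhcls] below show that every choice of representatives gives the same
    classes. *)
Definition cup (M N : bimodType A) (r s : int)
    (u : cohomology C M r) (v : cohomology C N s) :
    cohomology C (tensorA M N) (r + s) :=
  ccls (cup_cochain (hrep u) (hrep v)).

Definition cap (M N : bimodType A) (r s : int)
    (u : cohomology C M r) (z : homology C N s) :
    homology C (tensorA M N) (s - r) :=
  hhcls (cap_chain (hrep u) (hrep z)).

Lemma Delta_diff (j p q : int) x :
  tcomp (Delta j (cdiff C (j + 1) j x)) p q =
    dleft C C (p + 1) p q (tcomp (Delta (j + 1) x) (p + 1) q)
    + (-1) ^ p *: dright C C p (q + 1) q (tcomp (Delta (j + 1) x) p (q + 1)).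
Proof. by rewrite cmap_comm; apply: ctensor_diffE. Qed.

Lemma cup_rawE (M N : bimodType A) (n r s : int)
    (u : bimodhom (C r) M) (v : bimodhom (C s) N) x :
  cup_raw n u v x = tmap u v (tcomp (Delta n x) r s).
Proof. by []. Qed.

Lemma cup_raw_diff (M N : bimodType A) (n n' r r' s s' : int)
    (u : bimodhom (C r) M) (v : bimodhom (C s) N) :
  n' = n + 1 -> r' = r + 1 -> s' = s + 1 ->
  bimod_comp (cup_raw n u v) (cdiff C n' n) =
    cup_raw n' (bimod_comp u (cdiff C r' r)) v
    + (-1) ^ r *: cup_raw n' u (bimod_comp v (cdiff C s' s)).
Proof.
move=> -> -> ->; apply/bimodhom_eqP => x.
rewrite bimodhom_addE bimodhom_scaleE.
rewrite -[LHS]/(tmap u v (tcomp (Delta n (cdiff C (n + 1) n x)) r s)).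
rewrite Delta_diff (linD (bimodhom_linear _)) (linZ (bimodhom_linear _)) !cup_rawE.
congr (_ + _ *: _).
  apply: (tensorA_ext (f := bimod_comp (tmap u v) (dleft C C _ _ _))) => a b.
  rewrite -[LHS]/(tmap u v (dleft C C _ _ _ (tensA a b))).
  by rewrite /dleft !tmapE.
apply: (tensorA_ext (f := bimod_comp (tmap u v) (dright C C _ _ _))) => a b.
rewrite -[LHS]/(tmap u v (dright C C _ _ _ (tensA a b))).
by rewrite /dright !tmapE.
Qed.

Lemma cup_raw0l (M N : bimodType A) (n r s : int) (v : bimodhom (C s) N) :
  cup_raw n (0 : bimodhom (C r) M) v = 0.
Proof.
apply/bimodhom_eqP => x; rewrite cup_rawE.
apply: (tensorA_ext (f := tmap _ _) (g := 0)) => a b.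
by rewrite tmapE; apply: (lin0 (tens_linl _ _ _)).
Qed.

Lemma cup_raw0r (M N : bimodType A) (n r s : int) (u : bimodhom (C r) M) :
  cup_raw n u (0 : bimodhom (C s) N) = 0.
Proof.
apply/bimodhom_eqP => x; rewrite cup_rawE.
apply: (tensorA_ext (f := tmap _ _) (g := 0)) => a b.
by rewrite tmapE; apply: (lin0 (tens_linr _ _ _)).
Qed.

Lemma cup_rawDl (M N : bimodType A) (n r s : int)
    (u u' : bimodhom (C r) M) (v : bimodhom (C s) N) :
  cup_raw n (u + u') v = cup_raw n u v + cup_raw n u' v.
Proof.
apply/bimodhom_eqP => x; rewrite bimodhom_addE !cup_rawE.
apply: (tensorA_ext (f := tmap _ _) (g := tmap u v + tmap u' v)) => a b.
by rewrite bimodhom_addE !tmapE; apply: (linD (tens_linl _ _ _)).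
Qed.

Lemma cup_rawDr (M N : bimodType A) (n r s : int)
    (u : bimodhom (C r) M) (v v' : bimodhom (C s) N) :
  cup_raw n u (v + v') = cup_raw n u v + cup_raw n u v'.
Proof.
apply/bimodhom_eqP => x; rewrite bimodhom_addE !cup_rawE.
apply: (tensorA_ext (f := tmap _ _) (g := tmap u v + tmap u v')) => a b.
by rewrite bimodhom_addE !tmapE; apply: (linD (tens_linr _ _ _)).
Qed.

Lemma cup_rawZl (M N : bimodType A) (n r s : int) c
    (u : bimodhom (C r) M) (v : bimodhom (C s) N) :
  cup_raw n (c *: u) v = c *: cup_raw n u v.
Proof.
apply/bimodhom_eqP => x; rewrite bimodhom_scaleE !cup_rawE.
apply: (tensorA_ext (f := tmap _ _) (g := c *: tmap u v)) => a b.
by rewrite bimodhom_scaleE !tmapE; apply: (linZ (tens_linl _ _ _)).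
Qed.

Lemma cup_rawZr (M N : bimodType A) (n r s : int) c
    (u : bimodhom (C r) M) (v : bimodhom (C s) N) :
  cup_raw n u (c *: v) = c *: cup_raw n u v.
Proof.
apply/bimodhom_eqP => x; rewrite bimodhom_scaleE !cup_rawE.
apply: (tensorA_ext (f := tmap _ _) (g := c *: tmap u v)) => a b.
by rewrite bimodhom_scaleE !tmapE; apply: (linZ (tens_linr _ _ _)).
Qed.

Section CapRaw.
Variables (M N : bimodType A) (p r : int) (u : bimodhom (C r) M).

Fact cap_pair_balanced (n : N) :
  balanced (@ract k A (C p)) (@lact k A (C r))
    (fun x y => tensAe x (tensA (u y) n : tensorA M N)).
Proof.
split=> [y|x c y y'|x a y]; first exact: tens_linl.
- rewrite (bimodhom_linear u) -[RHS](tens_linr _ _ _).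
  by congr (tensAe _ _); apply: tens_linl.
- by rewrite bimodhom_lact -tensA_lact tensAe_lact.
Qed.

Lemma cap_pairE (n : N) x y :
  cap_pair u n (tensA x y : tensorA (C p) (C r)) = tensAe x (tensA (u y) n).
Proof. exact: tliftE (cap_pair_balanced n) x y. Qed.

Lemma cap_pair_linear (n : N) : linear (@cap_pair M N p r u n).
Proof. exact: tlift_linear (cap_pair_balanced n). Qed.

Lemma cap_pair_linn (t : tensorA (C p) (C r)) :
  linear (fun n : N => cap_pair u n t).
Proof.
move=> c n n'; elim/tensor_ind: t => [|x y t IH].
  by rewrite !(lin0 (cap_pair_linear _)) scaler0 addr0.
rewrite !(linD (cap_pair_linear _)) IH -/(tensA x y) !cap_pairE.
have -> : tensA (u y) (c *: n + n') = c *: tensA (u y) n + tensA (u y) n'.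
  exact: tens_linr.
by rewrite [X in X + _ = _](tens_linr _ _ _) scalerDr addrACA.
Qed.

Lemma cap_pair_bal (n : N) (t : tensorA (C p) (C r)) (a b : A) :
  cap_pair u n (ract (lact b t) a) = cap_pair u (ract (lact a n) b) t.
Proof.
elim/tensor_ind: t => [|x y t IH].
  by rewrite (lin0 (lact_linr b)) (lin0 (ract_linl a)) !(lin0 (cap_pair_linear _)).
rewrite (linD (lact_linr b)) (linD (ract_linl a)) !(linD (cap_pair_linear _)) IH.
congr (_ + _); rewrite -/(tensA x y) tensA_lact tensA_ract !cap_pairE.
by rewrite bimodhom_ract tensA_bal -tensA_ract tensAe_ract.
Qed.

Variable s : int.

Fact cap_raw_balanced :
  balanced (@Ae_ract k A (C s)) (@Ae_lact k A N)
    (fun a n => cap_pair u n (tcomp (Delta s a) p r)).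
Proof.
split=> [n c x y|a|x ab n].
- rewrite (bimodhom_linear (Delta s)) -[RHS](cap_pair_linear n).
  by congr cap_pair; apply: (bimodhom_linear (tcomp_hom C C s p r)).
- exact: cap_pair_linn.
rewrite /Ae_ract /Ae_lact -cap_pair_bal !(bimodhom_ract, bimodhom_lact).
congr cap_pair.
by rewrite -[LHS]/(tcomp_hom C C s p r _) bimodhom_ract bimodhom_lact.
Qed.

Lemma cap_rawE x n :
  cap_raw p u (tensAe x n : tensorAe (C s) N) =
    cap_pair u n (tcomp (Delta s x) p r).
Proof. exact: tliftE cap_raw_balanced x n. Qed.

Lemma cap_raw_linear : linear (@cap_raw M N s r p u).
Proof. exact: tlift_linear cap_raw_balanced. Qed.

End CapRaw.

Lemma cap_pair_linu (M N : bimodType A) (p r : int) (n : N)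
    (t : tensorA (C p) (C r)) :
  linear (fun u : bimodhom (C r) M => cap_pair u n t).
Proof.
move=> c u u'; elim/tensor_ind: t => [|x y t IH].
  by rewrite !(lin0 (cap_pair_linear _ _)) scaler0 addr0.
rewrite !(linD (cap_pair_linear _ _)) IH -/(tensA x y) !cap_pairE.
have -> : tensA ((c *: u + u') y) n = c *: tensA (u y) n + tensA (u' y) n.
  exact: tens_linl.
by rewrite [X in X + _ = _](tens_linr _ _ _) scalerDr addrACA.
Qed.

Lemma cap_raw_linu (M N : bimodType A) (s p r : int) (z : tensorAe (C s) N) :
  linear (fun u : bimodhom (C r) M => cap_raw p u z).
Proof.
move=> c u u'; elim/tensor_ind: z => [|x y z IH].
  by rewrite !(lin0 (@cap_raw_linear _ _ _ _ _ _)) scaler0 addr0.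
rewrite !(linD (@cap_raw_linear _ _ _ _ _ _)) IH -/(tensAe x y) !cap_rawE.
by rewrite [X in X + _ = _]cap_pair_linu scalerDr addrACA.
Qed.

Lemma cap_raw_diff (M N : bimodType A) (s s' p p' r r' : int)
    (u : bimodhom (C r) M) (z : tensorAe (C s') N) :
  s' = s + 1 -> p' = p + 1 -> r' = r + 1 ->
  cap_raw p u (bnd s z) =
    bnd p (cap_raw p' u z)
    + (-1) ^ p *: cap_raw p (bimod_comp u (cdiff C r' r)) z.
Proof.
move=> es ep er; subst s' p' r'; elim/tensor_ind: z => [|x n z IH].
  rewrite (lin0 (@bnd_linear _ _ _ _ _ _)) !(lin0 (@cap_raw_linear _ _ _ _ _ _)).
  by rewrite (lin0 (@bnd_linear _ _ _ _ _ _)) scaler0 addr0.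
rewrite (linD (@bnd_linear _ _ _ _ _ _)) !(linD (@cap_raw_linear _ _ _ _ _ _)).
rewrite (linD (@bnd_linear _ _ _ _ _ _)) IH scalerDr [RHS]addrACA.
congr (_ + _); rewrite -/(tensAe x n) /bnd tmapAeE !cap_rawE Delta_diff.
rewrite (linD (cap_pair_linear _ _)) (linZ (cap_pair_linear _ _)).
congr (_ + _ *: _).
  elim/tensor_ind: (tcomp _ _ _) => [|a b t IHt].
    rewrite (lin0 (bimodhom_linear _)) !(lin0 (cap_pair_linear _ _)).
    by rewrite (lin0 (tmapAe_linear _)).
  rewrite (linD (bimodhom_linear _)) !(linD (cap_pair_linear _ _)).
  rewrite (linD (tmapAe_linear _)) IHt; congr (_ + _).
  by rewrite -/(tensA a b) /dleft tmapE !cap_pairE tmapAeE.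
elim/tensor_ind: (tcomp _ _ _) => [|a b t IHt].
  by rewrite (lin0 (bimodhom_linear _)) !(lin0 (cap_pair_linear _ _)).
rewrite (linD (bimodhom_linear _)) !(linD (cap_pair_linear _ _)) IHt.
by congr (_ + _); rewrite -/(tensA a b) /dright tmapE !cap_pairE.
Qed.

Let sg_neq0 (n : int) : (-1) ^ n != 0 :> k.
Proof. by rewrite expfz_neq0 // oppr_eq0 oner_eq0. Qed.

Let cobnd_ex (X : bimodType A) i j (y : bimodhom (C i) X) (c : k) :
  exists y' : bimodhom (C i) X, c *: bimod_comp y (cdiff C j i) = cobnd j y'.
Proof.
exists (- (((-1) ^ i)^-1 * c) *: y); rewrite (linZ (@cobnd_linear _ _ _ _ _ _)).
by rewrite /cobnd scalerN scaleNr opprK scalerA mulrAC mulVf ?mul1r.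
Qed.

Let cocycle0 (X : bimodType A) n (u : bimodhom (C n) X) :
  cobnd (n + 1) u = 0 -> bimod_comp u (cdiff C (n + 1) n) = 0.
Proof. by move=> /cocycleP E; apply/bimodhom_eqP => x; apply: E. Qed.

Lemma cup_cocycle (M N : bimodType A) (r s : int)
    (u : bimodhom (C r) M) (v : bimodhom (C s) N) :
  cobnd (r + 1) u = 0 -> cobnd (s + 1) v = 0 ->
  cobnd (r + s + 1) (cup_cochain u v) = 0.
Proof.
move=> zu zv; rewrite (linZ (@cobnd_linear _ _ _ _ _ _)) /cobnd.
rewrite (cup_raw_diff u v erefl erefl erefl) !cocycle0 // cup_raw0l cup_raw0r.
by rewrite scaler0 addr0 scaler0 oppr0 scaler0.
Qed.

Let cup_coboundl (M N : bimodType A) (r s : int)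
    (w : bimodhom (C (r - 1)) M) (v : bimodhom (C s) N) :
  cobnd (s + 1) v = 0 ->
  exists y : bimodhom (C (r + s - 1)) _, cup_cochain (cobnd r w) v = cobnd _ y.
Proof.
move=> zv.
have E := @cup_raw_diff _ _ (r + s - 1) (r + s) (r - 1) r s (s + 1) w v
  (esym (subrK _ _)) (esym (subrK _ _)) erefl.
rewrite cocycle0 // cup_raw0r scaler0 addr0 in E.
rewrite /cup_cochain {1}/cobnd -scaleNr cup_rawZl -E scalerA.
exact: cobnd_ex.
Qed.

Let cup_coboundr (M N : bimodType A) (r s : int)
    (u : bimodhom (C r) M) (w : bimodhom (C (s - 1)) N) :
  cobnd (r + 1) u = 0 ->
  exists y : bimodhom (C (r + s - 1)) _, cup_cochain u (cobnd s w) = cobnd _ y.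
Proof.
move=> zu.
have E := @cup_raw_diff _ _ (r + s - 1) (r + s) r (r + 1) (s - 1) s u w
  (esym (subrK _ _)) erefl (esym (subrK _ _)).
rewrite cocycle0 // cup_raw0l add0r in E.
have {}E : cup_raw (r + s) u (bimod_comp w (cdiff C s (s - 1))) =
  ((-1) ^ r)^-1 *: bimod_comp (cup_raw (r + s - 1) u w) (cdiff C (r + s) (r + s - 1)).
  by rewrite E scalerA mulVf // scale1r.
rewrite /cup_cochain {1}/cobnd -scaleNr cup_rawZr E !scalerA.
exact: cobnd_ex.
Qed.

Lemma cup_ccls (M N : bimodType A) (r s : int)
    (u : bimodhom (C r) M) (v : bimodhom (C s) N) :
  cobnd (r + 1) u = 0 -> cobnd (s + 1) v = 0 ->
  cup (ccls u) (ccls v) = ccls (cup_cochain u v).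
Proof.
move=> zu zv; rewrite /cup /ccls.
have [w Ew] := hrep_hcls (@cobnd _ _ C M (r - 1) r) zu.
have [w' Ew'] := hrep_hcls (@cobnd _ _ C N (s - 1) s) zv.
have zu' := hrepP (hcls (@cobnd _ _ C M (r - 1) r) (@cobnd _ _ C M r (r + 1)) u).
have zv' := hrepP (hcls (@cobnd _ _ C N (s - 1) s) (@cobnd _ _ C N s (s + 1)) v).
move: (hrep _) Ew zu' (hrep _) Ew' zv' => u' Ew zu' v' Ew' zv'.
apply/hcls_eqP; [exact: cup_cocycle|exact: cup_cocycle|].
have [y Ey] := @cup_coboundl _ _ r s w v' zv'.
have [y' Ey'] := @cup_coboundr _ _ r s u w' zu.
exists (y + y'); rewrite linearD /=.
rewrite -Ey -Ey' -[cobnd r w]Ew -[cobnd s w']Ew' /cup_cochain.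
rewrite -scalerBr -scalerDr; congr (_ *: _).
rewrite cup_rawDl cup_rawDr -!scaleN1r cup_rawZl cup_rawZr.
by rewrite !scaleN1r addrA subrK.
Qed.

Lemma cap_cycle (M N : bimodType A) (r s : int)
    (u : bimodhom (C r) M) (z : tensorAe (C s) N) :
  cobnd (r + 1) u = 0 -> bnd (s - 1) z = 0 ->
  bnd (s - r - 1) (cap_chain u z) = 0.
Proof.
move=> zu zz; rewrite (linZ (@bnd_linear _ _ _ _ _ _)).
have := @cap_raw_diff _ _ (s - 1) s (s - r - 1) (s - r) r (r + 1) u z
  (esym (subrK _ _)) (esym (subrK _ _)) erefl.
rewrite zz cocycle0 // (lin0 (@cap_raw_linear _ _ _ _ _ _)).
by rewrite (lin0 (cap_raw_linu _ _)) scaler0 addr0 => <-; rewrite scaler0.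
Qed.

Let cap_boundr (M N : bimodType A) (r s : int)
    (u : bimodhom (C r) M) (z : tensorAe (C (s + 1)) N) :
  cobnd (r + 1) u = 0 ->
  exists y : tensorAe (C (s - r + 1)) _, cap_chain u (bnd s z) = bnd _ y.
Proof.
move=> zu; rewrite /cap_chain.
rewrite (@cap_raw_diff _ _ s (s + 1) (s - r) (s - r + 1) r (r + 1) u z) //.
rewrite cocycle0 // (lin0 (cap_raw_linu _ _)) scaler0 addr0.
by rewrite -(linZ (@bnd_linear _ _ _ _ _ _)); eexists.
Qed.

Let cap_boundl (M N : bimodType A) (r s : int)
    (w : bimodhom (C (r - 1)) M) (z : tensorAe (C s) N) :
  bnd (s - 1) z = 0 ->
  exists y : tensorAe (C (s - r + 1)) _, cap_chain (cobnd r w) z = bnd _ y.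
Proof.
move=> zz; rewrite /cap_chain /cobnd -scaleNr (linZ (cap_raw_linu _ _)).
have := @cap_raw_diff _ _ (s - 1) s (s - r) (s - r + 1) (r - 1) r w z
  (esym (subrK _ _)) erefl (esym (subrK _ _)).
rewrite zz (lin0 (@cap_raw_linear _ _ _ _ _ _)) => /esym/eqP.
rewrite addr_eq0 => /eqP E.
have {}E : cap_raw (s - r) (bimod_comp w (cdiff C r (r - 1))) z =
  bnd (s - r) (- ((-1) ^ (s - r))^-1 *: cap_raw (s - r + 1) w z).
  rewrite (linZ (@bnd_linear _ _ _ _ _ _)) scaleNr -scalerN E opprK scalerA.
  by rewrite mulVf // scale1r.
by rewrite E -!(linZ (@bnd_linear _ _ _ _ _ _)); eexists.
Qed.

Lemma cap_hhcls (M N : bimodType A) (r s : int)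
    (u : bimodhom (C r) M) (z : tensorAe (C s) N) :
  cobnd (r + 1) u = 0 -> bnd (s - 1) z = 0 ->
  cap (ccls u) (hhcls z) = hhcls (cap_chain u z).
Proof.
move=> zu zz; rewrite /cap /ccls /hhcls.
have [w Ew] := hrep_hcls (@cobnd _ _ C M (r - 1) r) zu.
have [w' Ew'] := hrep_hcls (@bnd _ _ C N (s + 1) s) zz.
have zu' := hrepP (hcls (@cobnd _ _ C M (r - 1) r) (@cobnd _ _ C M r (r + 1)) u).
have zz' := hrepP (hcls (@bnd _ _ C N (s + 1) s) (@bnd _ _ C N s (s - 1)) z).
move: (hrep _) Ew zu' (hrep _) Ew' zz' => u' Ew zu' z' Ew' zz'.
apply/hcls_eqP; [exact: cap_cycle|exact: cap_cycle|].
have [y Ey] := @cap_boundl _ _ r s w z' zz'.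
have [y' Ey'] := @cap_boundr _ _ r s u w' zu.
exists (y + y'); rewrite linearD /=.
rewrite -Ey -Ey' -[cobnd r w]Ew -[bnd s w']Ew' /cap_chain.
rewrite -scalerBr -scalerDr; congr (_ *: _).
rewrite (linD (cap_raw_linu _ _)) (linD (@cap_raw_linear _ _ _ _ _ _)).
rewrite -!scaleN1r (linZ (cap_raw_linu _ _)) (linZ (@cap_raw_linear _ _ _ _ _ _)).
by rewrite !scaleN1r addrA subrK.
Qed.

End Products.

Section Induced.
Variables (k : fieldType) (A : algType k) (C D : bicomplex A).
Variables (f : chain_map C D) (X : bimodType A).

(** As for the products, these are computed on representatives; see
    [cohomology_map_ccls] and [homology_map_hhcls]. *)
Definition cohomology_map n (c : cohomology D X n) : cohomology C X n :=
  ccls (bimod_comp (hrep c) (f n)).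

Definition homology_map n (c : homology C X n) : homology D X n :=
  hhcls (tmapAe (f n) (hrep c)).

Let cobnd_map i j (u : bimodhom (D i) X) :
  cobnd j (bimod_comp u (f i)) = bimod_comp (cobnd j u) (f j).
Proof.
apply/bimodhom_eqP => x.
rewrite -[LHS]/(- ((-1) ^ i *: u (f i (cdiff C j i x)))) cmap_comm.
by [].
Qed.

Let bnd_map i j (z : tensorAe (C i) X) :
  bnd j (tmapAe (f i) z) = tmapAe (f j) (bnd j z).
Proof.
elim/tensor_ind: z => [|x y z IH].
  by rewrite !(lin0 (tmapAe_linear _)) !(lin0 (@bnd_linear _ _ _ _ _ _))
     (lin0 (tmapAe_linear _)).
rewrite !(linD (tmapAe_linear _)) !(linD (@bnd_linear _ _ _ _ _ _)).
rewrite (linD (tmapAe_linear _)) IH; congr (_ + _).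
by rewrite -/(tensAe x y) /bnd !tmapAeE cmap_comm.
Qed.

Lemma cohomology_map_ccls n (u : bimodhom (D n) X) : cobnd (n + 1) u = 0 ->
  cohomology_map (ccls u) = ccls (bimod_comp u (f n)).
Proof.
move=> zu; rewrite /cohomology_map /ccls.
have [w Ew] := hrep_hcls (@cobnd _ _ D X (n - 1) n) zu.
have zu' := hrepP (hcls (@cobnd _ _ D X (n - 1) n) (@cobnd _ _ D X n (n + 1)) u).
move: (hrep _) Ew zu' => u' Ew zu'.
apply/hcls_eqP.
- by rewrite /= cobnd_map zu'; apply/bimodhom_eqP.
- by rewrite /= cobnd_map zu; apply/bimodhom_eqP.
exists (bimod_comp w (f (n - 1))); rewrite /= cobnd_map -[cobnd n w]Ew.
exact/bimodhom_eqP.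
Qed.

Lemma homology_map_hhcls n (z : tensorAe (C n) X) : bnd (n - 1) z = 0 ->
  homology_map (hhcls z) = hhcls (tmapAe (f n) z).
Proof.
move=> zz; rewrite /homology_map /hhcls.
have [w Ew] := hrep_hcls (@bnd _ _ C X (n + 1) n) zz.
have zz' := hrepP (hcls (@bnd _ _ C X (n + 1) n) (@bnd _ _ C X n (n - 1)) z).
move: (hrep _) Ew zz' => z' Ew zz'.
apply/hcls_eqP.
- by rewrite /= bnd_map zz' (lin0 (tmapAe_linear _)).
- by rewrite /= bnd_map zz (lin0 (tmapAe_linear _)).
exists (tmapAe (f (n + 1)) w); rewrite /= bnd_map -[bnd n w]Ew.
by rewrite (linD (tmapAe_linear _)) -!scaleN1r (linZ (tmapAe_linear _)).
Qed.

End Induced.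

Definition frobenius (k : fieldType) (A : falgType k) : Prop :=
  exists b : {biscalar A},
    [/\ forall x, (forall y, b x y = 0) -> x = 0,
        forall y, (forall x, b x y = 0) -> y = 0 &
        forall x y z, b (x * y) z = b x (y * z)].

Record complete_resolution (k : fieldType) (A : algType k) :=
  CompleteResolution {
  cr_complex :> bicomplex A;
  cr_fg : forall n, fg_bimod (cr_complex n);
  cr_projective : forall n, projective_bimod (cr_complex n);
  cr_acyclic : forall n x, cdiff cr_complex n (n - 1) x = 0 ->
    exists y, cdiff cr_complex (n + 1) n y = x;
  cr_eps : bimodhom (cr_complex 0) (regbimod A);
  cr_eta : bimodhom (regbimod A) (cr_complex (- 1));
  cr_eps_surj : forall a, exists x, cr_eps x = a;
  cr_eta_inj : injective cr_eta;
  cr_eps_eta : forall x, cdiff cr_complex 0 (- 1) x = cr_eta (cr_eps x)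
}.

Definition trunc_eps (k : fieldType) (A : algType k)
  (T : complete_resolution A) : bimodhom (trunc T 0) (regbimod A) := cr_eps T.

(** The isomorphism [A (x)_A A -> A], [x (x) y |-> x y]. *)
Section RegMul.
Variables (k : fieldType) (A : algType k).

Definition regmul (t : tensorA (regbimod A) (regbimod A)) : regbimod A :=
  tlift (fun x y : regbimod A => (x : A) * (y : A) : regbimod A) t.

Lemma regmulE (x y : regbimod A) : regmul (tensA x y) = (x : A) * (y : A).
Proof.
apply: (tliftE _ x y); split; [exact: reg_linl|exact: reg_linr|].
by move=> a b c; apply: esym; apply: mulrA.
Qed.

End RegMul.

(** [(eps (x)^ eps) Delta = eps]; as [eps] is extended by zero, only the
    component in [C 0 (x)_A C 0] matters. *)
Record diagonal_approx (k : fieldType) (A : algType k) (C : bicomplex A)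
    (eps : bimodhom (C 0) (regbimod A)) := DiagonalApprox {
  da_map :> chain_map C (ctensor C C);
  da_eps : forall x, regmul (tmap eps eps (tcomp (da_map 0 x) 0 0)) = eps x
}.

Section Canonical.
Variables (k : fieldType) (A : algType k) (T : complete_resolution A).

Definition tate_cohomology (X : bimodType A) (n : int) := cohomology T X n.
Definition tate_homology (X : bimodType A) (n : int) := homology T X n.
Definition hoch_cohomology (X : bimodType A) (n : int) :=
  cohomology (trunc T) X n.
Definition hoch_homology (X : bimodType A) (n : int) := homology (trunc T) X n.

Definition iota_map (X : bimodType A) (n : int) :
  hoch_cohomology X n -> tate_cohomology X n :=
  @cohomology_map k A T (trunc T) (theta T) X n.

Definition kappa_map (X : bimodType A) (n : int) :
  tate_homology X n -> hoch_homology X n :=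
  @homology_map k A T (trunc T) (theta T) X n.

End Canonical.

Arguments iota_map {k A T X n} c.
Arguments kappa_map {k A T X n} z.

(* Main.v *)
Require Import Defs.
From HB Require Import structures.
From mathcomp Require Import all_boot all_order all_algebra all_field.
From mathcomp Require Import boolp functions.
From mathcomp Require Import zify.

(** Write [P] for the truncation of [T] and [theta : T -> P] for the canonical
    map. The chain maps [D \o theta] and [(theta (x) theta) \o Dhat] from [T]
    to [P (x)_A P] both lift the augmentation of [T]. Since [P (x)_A P] is zero
    in negative degrees and is a resolution of [A], and since the [T_n] are
    projective, they are homotopic; evaluating a homotopy on cocycles and cycles
    gives the coboundaries and boundaries by which the two kinds of products
    differ. This yields (1), and [u cap kappa z = kappa (iota u cap^ z)] in all
    degrees [r], [s], hence (2), because [theta] is the identity in degrees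
    [>= 0].

    [P (x)_A P] is a resolution because a projective bimodule is projective as a
    right module, so that the augmented complex [P -> A] is contractible by
    right linear maps, and such maps can be tensored with [P] on the right. *)

Set Implicit Arguments.
Unset Strict Implicit.
Unset Printing Implicit Defensive.

Import Order.TTheory GRing.Theory Num.Theory.
Local Open Scope ring_scope.

(** * Lifting through projective bimodules *)

Section BimodImage.
Variables (k : fieldType) (A : algType k) (X Y : bimodType A).
Variable p : bimodhom X Y.

Definition bimod_image_pred : {pred Y} := fun y => `[< exists x, p x = y >].

Fact bimod_image_pred_closed : submod_closed bimod_image_pred.
Proof.
split=> [|c y y' /asboolP[x <-] /asboolP[x' <-]]; apply/asboolP.
  by exists 0; rewrite linear0.
by exists (c *: x + x'); rewrite linearP.
Qed.
HB.instance Definition _ :=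
  GRing.isSubmodClosed.Build k Y bimod_image_pred bimod_image_pred_closed.

Record bimod_image := BimodImage {
  bimod_image_val :> Y;
  _ : bimod_image_val \in bimod_image_pred
}.
HB.instance Definition _ := [isSub for bimod_image_val].
HB.instance Definition _ := [Choice of bimod_image by <:].
HB.instance Definition _ := [SubChoice_isSubLmodule of bimod_image by <:].

Fact bimod_image_lact_closed a (y : bimod_image) :
  lact a (val y) \in bimod_image_pred.
Proof.
case: y => y /= /asboolP[x <-]; apply/asboolP.
by exists (lact a x); rewrite bimodhom_lact.
Qed.
Fact bimod_image_ract_closed (y : bimod_image) a :
  ract (val y) a \in bimod_image_pred.
Proof.
case: y => y /= /asboolP[x <-]; apply/asboolP.
by exists (ract x a); rewrite bimodhom_ract.
Qed.

Let ilact a y : bimod_image := BimodImage (bimod_image_lact_closed a y).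
Let iract y a : bimod_image := BimodImage (bimod_image_ract_closed y a).

Fact ilact_linl y : linear (ilact^~ y).
Proof. by move=> c a b; apply/val_inj/lact_linl. Qed.
Fact ilact_linr a : linear (ilact a).
Proof. by move=> c x y; apply/val_inj/lact_linr. Qed.
Fact iract_linl a : linear (iract^~ a).
Proof. by move=> c x y; apply/val_inj/ract_linl. Qed.
Fact iract_linr y : linear (iract y).
Proof. by move=> c a b; apply/val_inj/ract_linr. Qed.
Fact ilact1 y : ilact 1 y = y. Proof. exact/val_inj/lact1. Qed.
Fact iract1 y : iract y 1 = y. Proof. exact/val_inj/ract1. Qed.
Fact ilactM a b y : ilact (a * b) y = ilact a (ilact b y).
Proof. exact/val_inj/lactM. Qed.
Fact iractM a b y : iract y (a * b) = iract (iract y a) b.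
Proof. exact/val_inj/ractM. Qed.
Fact ilract a b y : iract (ilact a y) b = ilact a (iract y b).
Proof. exact/val_inj/lract. Qed.

HB.instance Definition _ := @Lmodule_isBimodule.Build k A bimod_image
  ilact iract ilact_linl ilact_linr iract_linl iract_linr ilact1 iract1
  ilactM iractM ilract.

(** [projective_bimod] lifts along surjections only, so [p] and [f] are first corestricted to the
    image of [p]. *)
Lemma projective_lift_image (P : bimodType A) (f : bimodhom P Y) :
  projective_bimod P -> (forall z, exists x, p x = f z) ->
  exists g : bimodhom P X, forall z, p (g z) = f z.
Proof.
move=> projP fp.
have im_p x : p x \in bimod_image_pred by apply/asboolP; exists x.
have im_f z : f z \in bimod_image_pred by apply/asboolP/fp.
have hp : is_bimodhom (fun x => BimodImage (im_p x)).
  split=> [c x y|a x|x a]; apply: val_inj; first exact: (bimodhom_linear p).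
  - exact: bimodhom_lact.
  - exact: bimodhom_ract.
have hf : is_bimodhom (fun z => BimodImage (im_f z)).
  split=> [c x y|a x|x a]; apply: val_inj; first exact: (bimodhom_linear f).
  - exact: bimodhom_lact.
  - exact: bimodhom_ract.
have [[y im_y]|g pg] := projP _ _ (mk_bimodhom hp) (mk_bimodhom hf).
  by have /asboolP[x px] := im_y; exists x; apply: val_inj.
by exists g => z; have /(congr1 val) := pg z.
Qed.

End BimodImage.

(** The coinduced bimodule [Hom_k(A, X)], with [(b f) a = f (a b)] and
    [(f b) a = f a b]. *)
Section Coinduced.
Variables (k : fieldType) (A : algType k) (X : bimodType A).

Definition coind_pred : {pred A -> X} := fun f => `[< linear f >].

Record coind := Coind { coind_fun :> A -> X; _ : coind_fun \in coind_pred }.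
HB.instance Definition _ := [isSub for coind_fun].
HB.instance Definition _ := [Choice of coind by <:].

Fact coind_pred_closed : submod_closed coind_pred.
Proof.
split=> [|c f g /asboolP lf /asboolP lg]; apply/asboolP => d a b.
  by rewrite -[LHS]/0 -[RHS]/(d *: 0 + 0) scaler0 add0r.
have E x : (c *: f + g) x = c *: f x + g x by [].
by rewrite !E lf lg !scalerDr !scalerA addrACA [c * d]mulrC.
Qed.
HB.instance Definition _ :=
  GRing.isSubmodClosed.Build k _ coind_pred coind_pred_closed.
HB.instance Definition _ := [SubChoice_isSubLmodule of coind by <:].

Lemma coind_linear (f : coind) : linear f.
Proof. by case: f => f /= /asboolP. Qed.

Lemma coind_eqP (f g : coind) : f =1 g -> f = g.
Proof. by move=> E; apply/val_inj/funext. Qed.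

Definition mk_coind (f : A -> X) (lf : linear f) : coind := @Coind f (asboolT lf).

Fact coind_lact_linear b (f : coind) : linear (fun a => f (a * b)).
Proof. by move=> c x y; rewrite mulrDl -scalerAl coind_linear. Qed.
Fact coind_ract_linear (f : coind) b : linear (fun a => ract (f a) b).
Proof. by move=> c x y; rewrite coind_linear ract_linl. Qed.

Let clact b f := mk_coind (coind_lact_linear b f).
Let cract f b := mk_coind (coind_ract_linear f b).

Fact clact_linl f : linear (clact^~ f).
Proof.
move=> c a b; apply: coind_eqP => x /=.
by rewrite -[RHS]/(c *: f (x * a) + f (x * b)) mulrDr -scalerAr coind_linear.
Qed.
Fact clact_linr a : linear (clact a).
Proof. by move=> c f g; apply: coind_eqP. Qed.
Fact cract_linl a : linear (cract^~ a).
Proof. by move=> c f g; apply: coind_eqP => x; apply: ract_linl. Qed.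
Fact cract_linr f : linear (cract f).
Proof. by move=> c a b; apply: coind_eqP => x; apply: ract_linr. Qed.
Fact clact1 f : clact 1 f = f.
Proof. by apply: coind_eqP => x /=; rewrite mulr1. Qed.
Fact cract1 f : cract f 1 = f.
Proof. by apply: coind_eqP => x; apply: ract1. Qed.
Fact clactM a b f : clact (a * b) f = clact a (clact b f).
Proof. by apply: coind_eqP => x /=; rewrite mulrA. Qed.
Fact cractM a b f : cract f (a * b) = cract (cract f a) b.
Proof. by apply: coind_eqP => x; apply: ractM. Qed.
Fact clract a b f : cract (clact a f) b = clact a (cract f b).
Proof. by apply: coind_eqP. Qed.

HB.instance Definition _ := @Lmodule_isBimodule.Build k A coind
  clact cract clact_linl clact_linr cract_linl cract_linr clact1 cract1
  clactM cractM clract.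

End Coinduced.

(** * Right linear maps and their lifting *)

Section RightLift.
Variables (k : fieldType) (A : falgType k).

Definition right_hom (X Y : bimodType A) (f : X -> Y) : Prop :=
  linear f /\ forall x a, f (ract x a) = ract (f x) a.

Lemma right_hom_idB (X : bimodType A) (f : X -> X) :
  right_hom f -> right_hom (fun x => x - f x).
Proof.
move=> [lf rf]; split=> [c x y|x a].
  by rewrite lf scalerBr opprD -!addrA; congr (_ + _); rewrite addrCA.
by rewrite rf (linD (ract_linl a)) -scaleN1r -(linZ (ract_linl a)) scaleN1r.
Qed.

(** For [Y = X] and [e y = 1], subtracting this map from the identity gives a right linear
    projection onto the kernel of [e]. *)
Lemma right_hom_aug (X Y : bimodType A) (e : bimodhom X (regbimod A)) (y : Y) :
  right_hom (fun x => ract y (e x : A)).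
Proof.
split=> [c x x'|x a]; first by rewrite (bimodhom_linear e) ract_linr.
by rewrite bimodhom_ract -ractM.
Qed.

(** Since [A] is finite dimensional, preimages of the values of [f] on a basis can be chosen and
    extended linearly. *)
Lemma linear_lift (X Y : lmodType k) (p : {linear X -> Y}) (f : A -> Y) :
  linear f -> (forall a, exists x, p x = f a) ->
  exists2 g : A -> X, linear g & forall a, p (g a) = f a.
Proof.
move=> lf /choice[g0 pg0]; pose e := vbasis {: A}.
exists (fun a => \sum_i coord e i a *: g0 e`_i).
  move=> c a b; rewrite scaler_sumr -big_split /=; apply: eq_bigr => i _.
  by rewrite linearP scalerDl scalerA.
move=> a; rewrite linear_sum [in RHS](coord_vbasis (memvf a)).
pose f' : {linear A -> Y} := HB.pack f (GRing.isLinear.Build k A Y _ f lf).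
rewrite -[f _]/(f' _) linear_sum; apply: eq_bigr => i _.
by rewrite !linearZ /= pg0.
Qed.

(** Frobenius reciprocity: right linear maps [P -> X] are the bimodule
    homomorphisms [P -> Hom_k(A, X)]. *)
Lemma projective_right_lift (P X Y : bimodType A) (p : bimodhom X Y)
    (f : P -> Y) :
  projective_bimod P -> right_hom f -> (forall z, exists x, p x = f z) ->
  exists2 g : P -> X, right_hom g & forall z, p (g z) = f z.
Proof.
move=> projP [lf rf] fp.
(* The adjoint of [f] sends [z] to [a |-> f (a z)]. *)
have lfz z : linear (fun a => f (lact a z)).
  by move=> c a b; rewrite lact_linl lf.
have hf : is_bimodhom (fun z => mk_coind (lfz z)).
  split=> [c x y|a x|x a]; apply: coind_eqP => b /=.
  - by rewrite lact_linr lf.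
  - by rewrite -lactM.
  - by rewrite -lract rf.
have lp (h : coind X) : linear (fun a => p (h a)).
  by move=> c a b; rewrite coind_linear linearP.
have hp : is_bimodhom (fun h => mk_coind (lp h)).
  split=> [c x y|a x|x a]; apply: coind_eqP => b //=.
  - exact: (bimodhom_linear p).
  - exact: bimodhom_ract.
have [z|g pg] := projective_lift_image (p := mk_bimodhom hp)
  (f := mk_bimodhom hf) projP.
  have [a|h lh ph] := linear_lift (p := p) (lfz z); first exact: fp.
  by exists (mk_coind lh); apply: coind_eqP.
(* Evaluation at 1 undoes the adjunction; it is right linear because the right action on the
   coinduced bimodule is on values. *)
exists (fun z => g z 1); first split=> [c x y|x a].
- by rewrite (bimodhom_linear g).
- by rewrite bimodhom_ract.
by move=> z; have /(congr1 (fun h : coind Y => h 1)) := pg z; rewrite /= lact1.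
Qed.

End RightLift.

(** * The tensor square of the truncated resolution *)

Section TensorALinear.
Variables (k : fieldType) (A : algType k) (M N : bimodType A).

Lemma tensA_linl (n : N) : linear (fun m : M => tensA m n).
Proof. exact: tens_linl. Qed.

Lemma tensA_linr (m : M) : linear (fun n : N => tensA m n).
Proof. exact: tens_linr. Qed.

Lemma tensAe_linr (m : M) : linear (fun n : N => tensAe m n).
Proof. exact: tens_linr. Qed.

End TensorALinear.

Section RightTensor.
Variables (k : fieldType) (A : falgType k) (X X' Y : bimodType A).

(** The map [f (x) 1] for [f] only right linear: balancing over [A] involves just the right action
    on the first factor. *)
Definition tmap_right (f : X -> X') (t : tensorA X Y) : tensorA X' Y :=
  tlift (fun x y => tensA (f x) y) t.

Variables (f : X -> X').
Hypothesis rf : right_hom f.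

Fact tmap_right_balanced :
  balanced (@ract k A X) (@lact k A Y) (fun x y => tensA (f x) y).
Proof.
case: rf => lf af; split=> [y c x x'|x|x a y].
- by rewrite lf [LHS]tens_linl.
- exact: tens_linr.
- by rewrite af tensA_bal.
Qed.

Lemma tmap_rightE x y : tmap_right f (tensA x y) = tensA (f x) y.
Proof. exact: tliftE tmap_right_balanced x y. Qed.

Lemma tmap_right_linear : linear (tmap_right f).
Proof. exact: tlift_linear tmap_right_balanced. Qed.

End RightTensor.

Section Augmentation.
Variables (k : fieldType) (A : algType k) (X Y : bimodType A).
Variable e : bimodhom X (regbimod A).

(** The composite of [e (x) 1] with the isomorphism [A (x)_A Y -> Y]. *)
Definition aug_left (t : tensorA X Y) : Y :=
  tlift (fun x y => lact (e x : A) y) t.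

Fact aug_left_balanced :
  balanced (@ract k A X) (@lact k A Y) (fun x y => lact (e x : A) y).
Proof.
split=> [y c x x'|x c y y'|x a y].
- by rewrite (bimodhom_linear e) [LHS]lact_linl.
- exact: lact_linr.
- by rewrite bimodhom_ract -lactM.
Qed.

Lemma aug_leftE x y : aug_left (tensA x y) = lact (e x : A) y.
Proof. exact: tliftE aug_left_balanced x y. Qed.

Lemma aug_left_linear : linear aug_left.
Proof. exact: tlift_linear aug_left_balanced. Qed.

Lemma aug_left_tmap_left (X' : bimodType A) (f : bimodhom X' X) t :
  (forall x, e (f x) = 0) -> aug_left (tmap f (bimod_id Y) t) = 0.
Proof.
move=> ef; elim/tensor_ind: t => [|x y t IH].
  by rewrite (lin0 (bimodhom_linear _)) (lin0 aug_left_linear).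
rewrite (linD (bimodhom_linear _)) (linD aug_left_linear) IH addr0 -/(tensA x y) tmapE.
by rewrite aug_leftE ef (lin0 (lact_linl _)).
Qed.

End Augmentation.

Section AugmentationMap.
Variables (k : fieldType) (A : algType k) (X Y Y' : bimodType A).
Variable e : bimodhom X (regbimod A).

Lemma aug_left_tmap_right (g : bimodhom Y Y') t :
  aug_left e (tmap (bimod_id X) g t) = g (aug_left e t).
Proof.
elim/tensor_ind: t => [|x y t IH].
  by rewrite !(lin0 (bimodhom_linear _)) !(lin0 (aug_left_linear _)) (lin0 (bimodhom_linear _)).
rewrite (linD (bimodhom_linear _)) !(linD (aug_left_linear _)) (linD (bimodhom_linear _)) IH -/(tensA x y).
by rewrite tmapE !aug_leftE bimodhom_lact.
Qed.

Lemma regmul_linear : linear (@regmul k A).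
Proof.
apply: tlift_linear; split; [exact: reg_linl|exact: reg_linr|].
by move=> a b c; apply/esym/mulrA.
Qed.

(** Rewrites the augmentation of a tensor product as [e'] of an element of [Y], the form in which
    exactness of [T] at degree 0 applies. *)
Lemma regmul_tmap (e' : bimodhom Y (regbimod A)) t :
  regmul (tmap e e' t) = e' (aug_left e t).
Proof.
elim/tensor_ind: t => [|x y t IH].
  by rewrite (lin0 (bimodhom_linear _)) (lin0 regmul_linear) (lin0 (aug_left_linear _)) (lin0 (bimodhom_linear _)).
rewrite (linD (bimodhom_linear _)) (linD regmul_linear) (linD (aug_left_linear _)) (linD (bimodhom_linear _)) IH.
by rewrite -/(tensA x y) tmapE regmulE aug_leftE bimodhom_lact.
Qed.

End AugmentationMap.

Section ElementaryTensor.
Variables (k : fieldType) (A : algType k) (C D : bicomplex A).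

(** The family is [c (x) d] at position [(i, j)] and zero elsewhere. Testing [p <> i] is enough,
    because [p] determines [q] in total degree [n]. *)
Lemma ctensor_elt i j n (c : C i) (d : D j) : i + j = n ->
  exists z : ctensor_obj C D n, tcomp z i j = tensA c d /\
    forall p q, p <> i -> tcomp z p q = 0.
Proof.
move=> e; exists (fun w => match i =P (sval w).1, j =P (sval w).2 with
  | ReflectT ei, ReflectT ej => tensA (ecast p (C p) ei c) (ecast q (D q) ej d)
  | _, _ => 0 end); split=> [|p q ne]; rewrite /tcomp; case: eqP => //= e'.
  case: (i =P i) => // ei; case: (j =P j) => // ej.
  by rewrite (eq_irrelevance ei erefl) (eq_irrelevance ej erefl).
by case: (i =P p) => // ei; case: ne.
Qed.

Lemma tcompD n (x y : ctensor C D n) p q :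
  tcomp (x + y) p q = tcomp x p q + tcomp y p q.
Proof. exact: (linD (bimodhom_linear (tcomp_hom C D n p q))). Qed.

End ElementaryTensor.

Lemma PoszS (n : nat) : n.+1%:Z = n%:Z + 1.
Proof. by rewrite -addn1 PoszD. Qed.

(** * Exactness of the tensor square and null-homotopies into it *)

Section Resolution.
Variables (k : fieldType) (A : falgType k) (T : complete_resolution A).
Local Notation P := (trunc T).
Local Notation Q := (ctensor P P).
Local Notation eps := (cr_eps T).
Local Notation aug := (trunc_eps T).

Lemma cr_exact i j l (x : T j) : i = j - 1 -> l = j + 1 ->
  cdiff T j i x = 0 -> exists y, cdiff T l j y = x.
Proof. by move=> -> ->; apply: cr_acyclic. Qed.

(** The differential out of [T 0] factors through [eps], so the kernel of [eps] consists of
    cycles. *)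
Lemma cr_exact0 (x : T 0) : eps x = 0 -> exists y, cdiff T 1 0 y = x.
Proof.
by move=> ex; apply: (@cr_exact (- 1)) => //; rewrite cr_eps_eta ex linear0.
Qed.

Lemma cr_eps_diff (x : T 1) : eps (cdiff T 1 0 x) = 0.
Proof. by apply: (@cr_eta_inj _ _ T); rewrite -cr_eps_eta cdiffK linear0. Qed.

Lemma trunc_neg_eq i (x y : P i) : i < 0 -> x = y.
Proof. by case: i x y => // n x y _; apply: bimod_prod_ext; case. Qed.

Lemma tens_neg_eq0l i (X : bimodType A) (t : tensorA (P i) X) : i < 0 -> t = 0.
Proof.
move=> i0; elim/tensor_ind: t => // x y t ->.
by rewrite (trunc_neg_eq x 0 i0) (lin0 (tens_linl _ _ _)) addr0.
Qed.

Lemma tens_neg_eq0r i (X : bimodType A) (t : tensorA X (P i)) : i < 0 -> t = 0.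
Proof.
move=> i0; elim/tensor_ind: t => // x y t ->.
by rewrite (trunc_neg_eq y 0 i0) (lin0 (tens_linr _ _ _)) addr0.
Qed.

(** If [p + q < 0], one of [p], [q] is negative, so every component has a zero factor. *)
Lemma ctensor_neg_eq0 n (x : Q n) : n < 0 -> x = 0.
Proof.
move=> n0; apply: bimod_prod_ext => -[[p q] /= e].
case: (ltrP p 0) => p0; first exact: tens_neg_eq0l.
apply: tens_neg_eq0r; rewrite ltNge; apply/negP => q0.
by move: n0; rewrite -e ltNge addr_ge0.
Qed.

(** All three degrees are non-negative, where the truncation agrees with [T]. *)
Lemma trunc_exact i j l (x : P j) : j = i + 1 -> l = j + 1 -> 0 <= i ->
  cdiff P j i x = 0 -> exists y, cdiff P l j y = x.
Proof.
case: i => // i ej el _.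
have {}ej : j = i.+1 by rewrite ej PoszS.
have {}el : l = i.+2 by rewrite el ej !PoszS.
subst j l; apply: cr_exact; first by rewrite PoszS addrK.
exact: PoszS.
Qed.

(** The induction starts at [n = 0] because the kernel of [T 0 -> T (-1)] is that
    of [eps], and [eps] splits over the free right module [A]. *)
Lemma right_section (n : nat) : exists2 t : T n -> T n.+1, right_hom t &
  forall x, cdiff T n (n%:Z - 1) x = 0 -> cdiff T n.+1 n (t x) = x.
Proof.
elim: n => [|n [t [lt rt] dt]].
  have [x0 ex0] := cr_eps_surj T 1.
  (* The projection onto the kernel of [eps], which is the image of [T 1]; lifting it along the
     differential gives the section. *)
  pose f (x : T 0) := x - ract x0 (eps x : A).
  have rf : right_hom f by apply: right_hom_idB; apply: right_hom_aug.
  have ef x : eps (f x) = 0.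
    rewrite /f raddfB /= bimodhom_ract ex0.
    by rewrite -[ract _ _]/((1 : A) * eps x) mul1r subrr.
  have [t rt dt] := projective_right_lift (p := cdiff T 1 0)
    (@cr_projective _ _ T 0) rf (fun x => cr_exact0 (ef x)).
  exists t => // x dx; rewrite dt /f.
  suff -> : eps x = 0 by rewrite (lin0 (ract_linr x0)) subr0.
  by apply: (@cr_eta_inj _ _ T); rewrite -cr_eps_eta dx linear0.
(* The values of [f] are cycles, because [t] splits the differential on cycles, and [f] fixes
   cycles. Its lift is therefore the next section. *)
pose f (x : T n.+1) := x - t (cdiff T n.+1 n x).
have rf : right_hom f.
  apply: right_hom_idB; split=> [c x y|x a].
    by rewrite (bimodhom_linear (cdiff _ _ _)) lt.
  by rewrite bimodhom_ract rt.
have df x : cdiff T n.+1 n (f x) = 0 by rewrite raddfB /= dt ?cdiffK ?subrr.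
have en : n.+1%:Z - 1 = n by rewrite PoszS addrK.
have [x|g rg dg] := projective_right_lift (p := cdiff T n.+2 n.+1)
  (@cr_projective _ _ T n.+1) rf.
  by apply: (@cr_exact n) (df x) => //; rewrite -[in LHS]addn1 PoszD.
exists g => // x; rewrite en => dx.
by rewrite dg /f dx (lin0 lt) subr0.
Qed.

(** With [t_n] as in [right_section], the contraction is
    [s_n = t_n (1 - t_{n-1} d)]; this form makes the homotopy identity hold for
    any independent choices of the [t_n]. *)
Lemma trunc_contraction : exists (s : forall i j, P i -> P j) (x0 : T 0),
  [/\ forall i j, right_hom (s i j), eps x0 = 1,
      forall x, cdiff P 1 0 (s 0 1 x) = x - ract x0 (eps x : A) &
      forall h i j x, i = h + 1 -> j = i + 1 -> i <> 0 ->
        cdiff P j i (s i j x) + s h i (cdiff P i h x) = x].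
Proof.
have [x0 ex0] := cr_eps_surj T 1.
have [t rt dt] : exists2 t : forall n : nat, T n -> T n.+1,
    forall n, right_hom (t n) &
    forall (n : nat) (x : T n),
      cdiff T n (n%:Z - 1) x = 0 -> cdiff T n.+1 n (t n x) = x.
  pose t n := s2val (cid2 (right_section n)).
  by exists t => n; rewrite /t; case: (cid2 _).
(* [r n] is a right linear projection onto the cycles of [T n]: its values are cycles ([dr]) and it
   fixes boundaries ([rd]). The contraction is [t] after [r]. *)
pose r (n : nat) : T n -> T n :=
  match n with
  | 0 => fun x => x - ract x0 (eps x : A)
  | m.+1 => fun x => x - t m (cdiff T m.+1 m x)
  end.
have rr n : right_hom (r n).
  case: n => [|n]; apply: right_hom_idB; first exact: right_hom_aug.
  split=> [c x y|x a]; first by rewrite (bimodhom_linear (cdiff _ _ _)) (rt n).1.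
  by rewrite bimodhom_ract (rt n).2.
have dr (n : nat) (x : T n) : cdiff T n (n%:Z - 1) (r n x) = 0.
  case: n x => [|n] x /=.
    rewrite cr_eps_eta raddfB /= bimodhom_ract ex0.
    by rewrite -[ract _ _]/((1 : A) * eps x) mul1r subrr linear0.
  have -> : n.+1%:Z - 1 = n by rewrite PoszS addrK.
  rewrite raddfB /= dt ?subrr //; exact: cdiffK.
have rd (n : nat) (x : T n.+1) : r n (cdiff T n.+1 n x) = cdiff T n.+1 n x.
  case: n x => [|n] x /=.
    by rewrite cr_eps_diff (lin0 (ract_linr x0)) subr0.
  by rewrite cdiffK (lin0 (rt n).1) subr0.
(* Zero unless [0 <= i] and [j = i + 1]; the transport disappears in [sE], where the target degree
   is literally the successor. *)
pose s i j : P i -> P j :=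
  match i, j with
  | Posz m, Posz n =>
    match m.+1 =P n with
    | ReflectT e => fun x => ecast l (T (Posz l)) e (t m (r m x))
    | ReflectF _ => fun=> 0
    end
  | _, _ => fun=> 0
  end.
have sE (n : nat) (x : T n) : s n n.+1 x = t n (r n x).
  by rewrite /s; case: eqP => // e; rewrite (eq_irrelevance e erefl).
exists s, x0; split=> //.
- case=> i [] j; rewrite /s /=; try by
    split=> [c x y|x a]; rewrite ?scaler0 ?add0r ?(lin0 (ract_linl a)).
  case: eqP => [e|_]; last first.
    by split=> [c x y|x a]; rewrite ?scaler0 ?add0r ?(lin0 (ract_linl a)).
  case: _ / e; split=> [c x y|x a] /=; first by rewrite (rr i).1 (rt i).1.
  by rewrite (rr i).2 (rt i).2.
- by move=> x; rewrite sE dt //; apply: dr.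
move=> h i j x ei ej i0.
case: i x ei ej i0 => [[|n]|n] x ei ej i0 //; last exact: trunc_neg_eq.
have {}ei : h = n by apply: (addIr 1); rewrite -ei PoszS.
rewrite -PoszS in ej; subst h j; rewrite !sE.
(* Here [d s x = r x = x - t (d x)], while [s d x = t (r (d x)) = t (d x)]. *)
have -> : cdiff P n.+2 n.+1 (t n.+1 (r n.+1 x)) = r n.+1 x by apply: dt; apply: dr.
by rewrite [cdiff P _ _ _]/(cdiff T n.+1 n x) rd /= subrK.
Qed.

(** A cycle [x] is the boundary of [(s (x) 1) x + x0 (x) y'], where [y'] bounds
    the image of [x] under [eps (x) 1 : P (x)_A P -> A (x)_A P = P]. *)
Lemma ctensor_trunc_exact m n l (x : Q n) : n = m + 1 -> l = n + 1 ->
  (n = 0 -> regmul (tmap aug aug (tcomp x 0 0)) = 0) ->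
  cdiff Q n m x = 0 -> exists y, cdiff Q l n y = x.
Proof.
move=> en el ex dx; case: (ltrP n 0) => n0.
  by exists 0; rewrite linear0 [RHS]ctensor_neg_eq0.
have [s [x0 [rs ex0 ds0 ds]]] := trunc_contraction.
have lH i j := tmap_right_linear (Y := P _) (rs i j).
(* The component of [d x = 0] at [(h, q)], solved for its [d (x) 1] part. *)
have dxE p h q : p = h + 1 ->
    dleft P P p h q (tcomp x p q) =
    - ((-1) ^ h *: dright P P h (q + 1) q (tcomp x h (q + 1))).
  move=> ->; subst n; apply/eqP; rewrite -addr_eq0 -ctensor_diffE; apply/eqP.
  by rewrite -[ctensor_diff _ _ _ _ _]/(cdiff Q (m + 1) m x) dx
    -[LHS]/(tcomp_hom P P _ _ _ 0) linear0.
pose y := aug_left aug (tcomp x 0 n).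
have [y' dy'] : exists y' : P l, cdiff P l n y' = y.
  (* For [0 <= m], [y] is a cycle: [dxE] trades [1 (x) d] for [d (x) 1] up to sign, and the
     augmentation kills the latter. Otherwise [n = 0], and the assumption in degree 0 says
     [eps y = 0]. *)
  case: (ltrP m 0) => m0; last first.
    apply: (trunc_exact en el m0).
    rewrite /y -aug_left_tmap_right -/(dright P P 0 n m (tcomp x 0 n)).
    have := dxE 1 0 m erefl; rewrite -en expr0z scale1r => /esym/(canRL (@opprK _)) ->.
    rewrite -scaleN1r (linZ (aug_left_linear _)) aug_left_tmap_left ?scaler0 //.
    exact: cr_eps_diff.
  have n00 : n = 0 by lia.
  clear en; subst n l; have [|y' dy'] := @cr_exact0 y; last by exists y'.
  by rewrite /y -[cr_eps T]/aug -regmul_tmap ex.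
have [z [z0 zn]] := @ctensor_elt _ _ P P 0 l l x0 y' (add0r l).
(* [Hx] is [(s (x) 1) x]: as [s] raises the first degree, position [(p, q)] receives the component
   of [x] at [(p - 1, q)]. *)
pose Hx : Q l := fun w => tmap_right (s ((sval w).1 - 1) (sval w).1)
  (tcomp x ((sval w).1 - 1) (sval w).2).
have HxE h p q : p = h + 1 -> tcomp Hx p q = tmap_right (s h p) (tcomp x h q).
  move=> ->; have [e|/eqP ne] := eqVneq (h + 1 + q) l.
    by rewrite (tcompE Hx (exist _ (h + 1, q) e)) /Hx /= addrK.
  rewrite !tcomp_out ?(lin0 (lH _ _ _)) // => e; apply: ne.
  by rewrite el -e addrAC.
exists (Hx + z); subst l.
apply: bimod_prod_ext => w; rewrite -!tcompE.
case: w => -[p q] /= epq.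
case: (ltrP p 0) => p0; first by rewrite [LHS]tens_neg_eq0l // [RHS]tens_neg_eq0l.
have [h ep] : exists h, p = h + 1 by exists (p - 1); rewrite subrK.
rewrite ctensor_diffE !tcompD (zn (p + 1)); last by lia.
rewrite addr0 (HxE p) // (HxE h) //.
(* For [p = 0], [d s = 1 - x0 eps]; the missing part [x0 eps(a) (x) b = x0 (x) eps(a) b] is restored
   by [z], whose boundary there is [x0 (x) y]. *)
have [p_0|/eqP p_n0] := eqVneq p 0.
  move: ep epq; subst p; rewrite add0r => ep epq; subst q.
  rewrite (tens_neg_eq0l (tcomp x h _)); last by lia.
  rewrite (lin0 (lH _ _ _)) !add0r expr0z scale1r z0.
  have -> : dright P P 0 (n + 1) n (tensA (x0 : P 0) y') = tensA (x0 : P 0) y.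
    by rewrite /dright tmapE dy'.
  rewrite /y; elim/tensor_ind: (tcomp x 0 n) => [|a b t IH].
    rewrite (lin0 (lH _ _ _)) (lin0 (bimodhom_linear _)) (lin0 (aug_left_linear _)).
    by rewrite (lin0 (tensA_linr _)) addr0.
  rewrite (linD (lH _ _ _)) (linD (bimodhom_linear _)) (linD (aug_left_linear _)).
  rewrite (linD (tensA_linr _)) addrACA IH; congr (_ + _).
  rewrite -!/(tensA _ _) tmap_rightE // /dleft tmapE [cdiff _ _ _ _]ds0.
  rewrite aug_leftE -tensA_bal -(linD (tensA_linl _)).
  by rewrite subrK.
rewrite zn // addr0.
(* As [p = h + 1], the sign [(-1) ^ p] cancels the minus sign of [dxE]. What remains is
   [(d s + s d) (x) 1], the identity for [p > 0]. *)
have -> : (-1) ^ p *: dright P P p (q + 1) q (tmap_right (s h p) (tcomp x h (q + 1)))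
    = tmap_right (s h p) (dleft P P p h q (tcomp x p q)).
  rewrite dxE // -scaleNr (linZ (lH _ _ _)) ep exprzDr ?unitrN1 // expr1z mulrN1.
  congr (_ *: _); elim/tensor_ind: (tcomp x h _) => [|a b t IH].
    by rewrite !(lin0 (bimodhom_linear _), lin0 (lH _ _ _)).
  rewrite !(linD (bimodhom_linear _), linD (lH _ _ _)) IH; congr (_ + _).
  by rewrite -!/(tensA _ _) /dright !(tmap_rightE, tmapE).
elim/tensor_ind: (tcomp x p q) => [|a b t IH].
  by rewrite !(lin0 (bimodhom_linear _), lin0 (lH _ _ _)) addr0.
rewrite !(linD (bimodhom_linear _), linD (lH _ _ _)) addrACA IH; congr (_ + _).
rewrite -!/(tensA _ _) /dleft !(tmap_rightE, tmapE) //.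
by rewrite -(linD (tensA_linl _)) ds.
Qed.

(** A null-homotopy around a single degree [n], which suffices for the products
    and avoids a compatible choice in all degrees. *)
Lemma ctensor_homotopy (phi : forall n, bimodhom (T n) (Q n)) :
  (forall i j x, phi j (cdiff T i j x) = cdiff Q i j (phi i x)) ->
  (forall x, regmul (tmap aug aug (tcomp (phi 0 x) 0 0)) = 0) ->
  forall n, exists (h : bimodhom (T n) (Q (n + 1)))
                   (h' : bimodhom (T (n - 1)) (Q n)),
    forall x, phi n x = cdiff Q (n + 1) n (h x) + h' (cdiff T n (n - 1) x).
Proof.
move=> dphi ephi.
have lift (i j l : int) (f : bimodhom (T j) (Q j)) : j = i + 1 -> l = j + 1 ->
    (forall x, j = 0 -> regmul (tmap aug aug (tcomp (f x) 0 0)) = 0) ->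
    (forall x, cdiff Q j i (f x) = 0) ->
    exists h : bimodhom (T j) (Q l), forall x, cdiff Q l j (h x) = f x.
  move=> ej el ef df.
  apply: (projective_lift_image (p := cdiff Q l j)) => [|x].
    exact: cr_projective.
  exact: (ctensor_trunc_exact ej el (ef x) (df x)).
have main (n : nat) (i j l : int) : j = n -> j = i + 1 -> l = j + 1 ->
    exists (h : bimodhom (T j) (Q l)) (h' : bimodhom (T i) (Q j)),
    forall x, phi j x = cdiff Q l j (h x) + h' (cdiff T j i x).
  elim: n i j l => [|n IH] i j l ->{j} ei el.
    (* In degree 0 the values of [phi] are cycles because [Q] vanishes below 0, so the lower
       homotopy can be zero. *)
    have [||h dh] := lift i _ l (phi 0) ei el.
    - by move=> x _; apply: ephi.
    - move=> x; apply: ctensor_neg_eq0.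
      by rewrite -(ltrD2r 1) -ei.
    by exists h, 0 => x; rewrite dh addr0.
  have {}ei : i = n by apply: (addIr 1); rewrite -ei PoszS.
  subst i.
  have [h [h' dh]] := IH (n%:Z - 1) n n.+1 erefl (esym (subrK _ _)) (PoszS n).
  (* [phi - h d] takes values in cycles: [d phi = phi d = d h d] by induction and [d d = 0]. Its
     lift is the upper homotopy, and [h] becomes the lower one. *)
  have [||g dg] := lift n n.+1 l (phi n.+1 - bimod_comp h (cdiff T n.+1 n))
    (PoszS n) el.
  - by [].
  - move=> x; rewrite bimodhom_addE bimodhom_oppE raddfB.
    rewrite -[LHS]/(cdiff Q n.+1 n (phi n.+1 x) -
                    cdiff Q n.+1 n (h (cdiff T n.+1 n x))).
    by rewrite -dphi dh cdiffK linear0 addr0 subrr.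
  by exists g, h => x; rewrite dg bimodhom_addE bimodhom_oppE subrK.
move=> n; case: (lerP 0 n) => n0.
  by case: n n0 => // n _; apply: (main n); rewrite ?subrK.
exists 0, 0 => x; rewrite linear0 add0r; exact: ctensor_neg_eq0.
Qed.

End Resolution.

(** * Comparison of the products *)

Section CtensorMap.
Variables (k : fieldType) (A : algType k) (C C' D D' : bicomplex A).
Variables (f : chain_map C C') (g : chain_map D D').

Definition ctensor_map_fun n (x : ctensor C D n) : ctensor C' D' n :=
  fun w => tmap (f _) (g _) (x w).

Fact ctensor_map_is_bimodhom n : is_bimodhom (@ctensor_map_fun n).
Proof.
split=> [c x y|a x|x a]; apply: bimod_prod_ext => w.
- exact: bimodhom_linear.
- exact: bimodhom_lact.
- exact: bimodhom_ract.
Qed.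

Definition ctensor_map_obj n : bimodhom (ctensor C D n) (ctensor C' D' n) :=
  mk_bimodhom (@ctensor_map_is_bimodhom n).

Lemma tcomp_ctensor_map n x p q :
  tcomp (ctensor_map_obj n x) p q = tmap (f p) (g q) (tcomp x p q).
Proof. by rewrite /tcomp; case: eqP => // _; rewrite linear0. Qed.

Fact ctensor_map_comm i j x :
  ctensor_map_obj j (cdiff (ctensor C D) i j x) =
  cdiff (ctensor C' D') i j (ctensor_map_obj i x).
Proof.
have [ei|/eqP ne] := eqVneq i (j + 1); last first.
  by rewrite !cdiff_out // linear0.
subst i; apply: bimod_prod_ext => w; rewrite -!tcompE tcomp_ctensor_map.
rewrite !ctensor_diffE !tcomp_ctensor_map.
move: (sval w).1 (sval w).2 => p q.
rewrite (linD (bimodhom_linear _)) (linZ (bimodhom_linear _)).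
congr (_ + _ *: _).
  elim/tensor_ind: (tcomp _ _ _) => [|a b t IH].
    by rewrite !(lin0 (bimodhom_linear _)).
  rewrite !(linD (bimodhom_linear _)) IH; congr (_ + _).
  by rewrite -!/(tensA _ _) /dleft !tmapE cmap_comm.
elim/tensor_ind: (tcomp _ _ _) => [|a b t IH].
  by rewrite !(lin0 (bimodhom_linear _)).
rewrite !(linD (bimodhom_linear _)) IH; congr (_ + _).
by rewrite -!/(tensA _ _) /dright !tmapE cmap_comm.
Qed.

Definition ctensor_map : chain_map (ctensor C D) (ctensor C' D') :=
  ChainMap ctensor_map_comm.

End CtensorMap.

Lemma tmap_comp (k : fieldType) (A : algType k) (L L' L'' R R' R'' : bimodType A)
    (f' : bimodhom L' L'') (f : bimodhom L L')
    (g' : bimodhom R' R'') (g : bimodhom R R') t :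
  tmap f' g' (tmap f g t) = tmap (bimod_comp f' f) (bimod_comp g' g) t.
Proof.
elim/tensor_ind: t => [|x y t IH]; first by rewrite !(lin0 (bimodhom_linear _)).
by rewrite !(linD (bimodhom_linear _)) IH -!/(tensA _ _) !tmapE.
Qed.

Section TmapAe.
Variables (k : fieldType) (A : algType k) (L M' M'' N : bimodType A).

Lemma tmapAe_comp (g : bimodhom M' M'') (f : bimodhom L M') (t : tensorAe L N) :
  tmapAe g (tmapAe f t) = tmapAe (bimod_comp g f) t.
Proof.
elim/tensor_ind: t => [|x y t IH]; first by rewrite !(lin0 (tmapAe_linear _)).
by rewrite !(linD (tmapAe_linear _)) IH -!/(tensAe _ _) !tmapAeE.
Qed.

Lemma tmapAeD (f g : bimodhom L M') (t : tensorAe L N) :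
  tmapAe (f + g) t = tmapAe f t + tmapAe g t.
Proof.
elim/tensor_ind: t => [|x y t IH].
  by rewrite !(lin0 (tmapAe_linear _)) addr0.
rewrite !(linD (tmapAe_linear _)) IH addrACA; congr (_ + _).
by rewrite -!/(tensAe _ _) !tmapAeE; apply: (linD (tens_linl _ _ _)).
Qed.

Lemma tmapAe_cancel (f : bimodhom L M') (g : bimodhom M' L) :
  cancel f g -> cancel (tmapAe f : tensorAe L N -> _) (tmapAe g).
Proof.
move=> fK; elim/tensor_ind => [|x y t IH].
  by rewrite !(lin0 (tmapAe_linear _)).
by rewrite !(linD (tmapAe_linear _)) IH -!/(tensAe _ _) !tmapAeE fK.
Qed.

End TmapAe.

Lemma bnd_tmapAe (k : fieldType) (A : algType k) (C D : bicomplex A)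
    (f : chain_map C D) (X : bimodType A) i j (z : tensorAe (C i) X) :
  bnd j (tmapAe (f i) z) = tmapAe (f j) (bnd j z).
Proof.
rewrite /bnd !tmapAe_comp; congr tmapAe.
by apply/bimodhom_eqP => x; apply/esym/cmap_comm.
Qed.

Lemma comp_cocycle (k : fieldType) (A : algType k) (C D : bicomplex A)
    (f : chain_map C D) (X : bimodType A) n (u : bimodhom (D n) X) :
  cobnd (n + 1) u = 0 -> cobnd (n + 1) (bimod_comp u (f n)) = 0.
Proof.
move=> /cocycleP du; apply/cocycleP => x.
by rewrite -[LHS]/(u (f n (cdiff C (n + 1) n x))) cmap_comm.
Qed.

Section CapEval.
Variables (k : fieldType) (A : algType k) (C : bicomplex A) (M N : bimodType A).
Variables (p r : int) (u : bimodhom (C r) M).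

(** [(x (x) y) (x) n |-> x (x) (u y (x) n)] *)
Definition cap_eval (z : tensorAe (tensorA (C p) (C r)) N) :
    tensorAe (C p) (tensorA M N) :=
  tlift (fun t n => cap_pair u n t) z.

Fact cap_eval_balanced :
  balanced (@Ae_ract k A (tensorA (C p) (C r))) (@Ae_lact k A N)
    (fun t n => cap_pair u n t).
Proof.
split=> [n|t|t ab n]; first exact: cap_pair_linear.
- exact: cap_pair_linn.
- exact: cap_pair_bal.
Qed.

Lemma cap_evalE t n : cap_eval (tensAe t n) = cap_pair u n t.
Proof. exact: tliftE cap_eval_balanced t n. Qed.

Lemma cap_eval_linear : linear cap_eval.
Proof. exact: tlift_linear cap_eval_balanced. Qed.

End CapEval.

Section CapEvalProps.
Variables (k : fieldType) (A : algType k) (C : bicomplex A) (M N : bimodType A).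

(** Isolates the diagonal in a bimodule map applied to the chain, so that the homotopy identity can
    be substituted there. *)
Lemma cap_raw_eval (Delta : chain_map C (ctensor C C)) (s p r : int)
    (u : bimodhom (C r) M) (z : tensorAe (C s) N) :
  cap_raw Delta p u z =
  cap_eval u (tmapAe (bimod_comp (tcomp_hom C C s p r) (Delta s)) z).
Proof.
elim/tensor_ind: z => [|x n z IH].
  rewrite (lin0 (tmapAe_linear _)) (lin0 (cap_eval_linear _)).
  by rewrite (lin0 (@cap_raw_linear _ _ _ _ _ _ _ _ _ _)).
rewrite (linD (tmapAe_linear _)) (linD (cap_eval_linear _)).
rewrite (linD (@cap_raw_linear _ _ _ _ _ _ _ _ _ _)) IH; congr (_ + _).
by rewrite -!/(tensAe _ _) cap_rawE tmapAeE cap_evalE.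
Qed.

(** The [1 (x) d] part of the differential vanishes because [u d = 0]; the [d (x) 1] part becomes
    the boundary. *)
Lemma cap_eval_diff (p r n : int) (u : bimodhom (C r) M)
    (w : tensorAe (ctensor C C (n + 1)) N) :
  (forall x, u (cdiff C (r + 1) r x) = 0) ->
  cap_eval u (tmapAe (bimod_comp (tcomp_hom C C n p r)
                                 (cdiff (ctensor C C) (n + 1) n)) w) =
  bnd p (cap_eval u (tmapAe (tcomp_hom C C (n + 1) (p + 1) r) w)).
Proof.
move=> du; elim/tensor_ind: w => [|x y w IH].
  by rewrite !(lin0 (tmapAe_linear _), lin0 (cap_eval_linear _)) linear0.
rewrite !(linD (tmapAe_linear _), linD (cap_eval_linear _)).
rewrite (linD (@bnd_linear _ _ _ _ _ _)) IH; congr (_ + _).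
rewrite -!/(tensAe _ _) !(tmapAeE, cap_evalE).
rewrite -[bimod_comp _ _ _]/(tcomp (ctensor_diff C C (n + 1) n x) p r).
rewrite ctensor_diffE (linD (cap_pair_linear _ _)) (linZ (cap_pair_linear _ _)).
rewrite [X in _ *: X](_ : _ = 0) ?scaler0 ?addr0; last first.
  elim/tensor_ind: (tcomp _ _ _) => [|a b t IHt].
    by rewrite (lin0 (bimodhom_linear _)) (lin0 (cap_pair_linear _ _)).
  rewrite (linD (bimodhom_linear _)) (linD (cap_pair_linear _ _)) IHt addr0.
  rewrite -!/(tensA _ _) /dright tmapE cap_pairE du.
  by rewrite (lin0 (tensA_linl _)) (lin0 (tensAe_linr _)).
rewrite -[tcomp_hom _ _ _ _ _ _]/(tcomp x (p + 1) r).
elim/tensor_ind: (tcomp _ _ _) => [|a b t IHt].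
  by rewrite (lin0 (bimodhom_linear _)) !(lin0 (cap_pair_linear _ _)) linear0.
rewrite (linD (bimodhom_linear _)) !(linD (cap_pair_linear _ _)).
rewrite (linD (@bnd_linear _ _ _ _ _ _)) -IHt.
congr (_ + _).
by rewrite -!/(tensA _ _) /dleft tmapE !cap_pairE /bnd tmapAeE.
Qed.

End CapEvalProps.

Section Comparison.
Variables (k : fieldType) (A : falgType k) (T : complete_resolution A).
Variables (Dhat : diagonal_approx (cr_eps T)) (D : diagonal_approx (trunc_eps T)).
Local Notation P := (trunc T).
Local Notation Q := (ctensor P P).
Local Notation th := (theta T).

(** Both maps lift the augmentation, so their difference augments to zero. Evaluated on cocycles,
    the [h] term vanishes and the [h'] term is a coboundary; evaluated on a cycle, the [h'] term
    vanishes and the [h] term is a boundary. *)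
Lemma diagonal_homotopy n :
  exists (h : bimodhom (T n) (Q (n + 1))) (h' : bimodhom (T (n - 1)) (Q n)),
  forall x, D n (th n x) = ctensor_map th th n (Dhat n x) +
    (cdiff Q (n + 1) n (h x) + h' (cdiff T n (n - 1) x)).
Proof.
pose phi n := bimod_comp (D n) (th n) - bimod_comp (ctensor_map th th n) (Dhat n).
have phiE m x : phi m x = D m (th m x) - ctensor_map th th m (Dhat m x) by [].
have [i j x|x|h [h' hh']] := ctensor_homotopy (phi := phi) _ _ n; last first.
- by exists h, h' => x; rewrite -hh' phiE addrC subrK.
- rewrite phiE addrC -scaleN1r.
  rewrite [tcomp _ 0 0](bimodhom_linear (tcomp_hom P P 0 0 0)).
  rewrite (bimodhom_linear (tmap _ _)) regmul_linear.
  rewrite -[tcomp_hom _ _ _ _ _ _]/(tcomp (ctensor_map_obj th th 0 (Dhat 0 x)) 0 0).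
  rewrite tcomp_ctensor_map tmap_comp (da_eps D).
  have -> : bimod_comp (trunc_eps T) (th 0) = cr_eps T by apply/bimodhom_eqP.
  by rewrite (da_eps Dhat) scaleN1r addNr.
rewrite !phiE !cmap_comm; exact/esym/(raddfB (cdiff Q i j)).
Qed.

Lemma iota_cup (M N : bimodType A) (r s : int)
    (u : hoch_cohomology T M r) (v : hoch_cohomology T N s) :
  iota_map (cup D u v) = cup Dhat (iota_map u) (iota_map v).
Proof.
have zu := hrepP u; have zv := hrepP v.
have /cocycleP du := zu; have /cocycleP dv := zv.
rewrite /iota_map {1}/cup cohomology_map_ccls; last exact: cup_cocycle.
rewrite {1}/cohomology_map {1}/cohomology_map cup_ccls; try exact: comp_cocycle.
move: (hrep u) (hrep v) zu zv du dv => {}u {}v zu zv du dv.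
have [h [h' hh']] := diagonal_homotopy (r + s).
apply/hcls_eqP.
- by apply: comp_cocycle; apply: cup_cocycle.
- by apply: cup_cocycle; apply: comp_cocycle.
set w := bimod_comp (tmap u v) (bimod_comp (tcomp_hom P P (r + s) r s) h').
have E x : cup_raw D (r + s) u v (th (r + s) x) =
    cup_raw Dhat (r + s) (bimod_comp u (th r)) (bimod_comp v (th s)) x +
    w (cdiff T (r + s) (r + s - 1) x).
  rewrite !cup_rawE hh' 2!tcompD 2!(linD (bimodhom_linear _)); congr (_ + _).
    by rewrite tcomp_ctensor_map tmap_comp.
  (* The [h] term: the two parts of the tensor differential produce [u d] and [v d], both zero. *)
  rewrite [X in X + _](_ : _ = 0) ?add0r // ctensor_diffE (linD (bimodhom_linear _)) (linZ (bimodhom_linear _)).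
  rewrite /dleft /dright !tmap_comp.
  have -> : bimod_comp u (cdiff P (r + 1) r) = 0 by apply/bimodhom_eqP.
  have -> : bimod_comp v (cdiff P (s + 1) s) = 0 by apply/bimodhom_eqP.
  have l0 (t : tensorA (P (r + 1)) (P s)) :
      tmap (0 : bimodhom _ M) (bimod_comp v (bimod_id _)) t = 0.
    apply: (tensorA_ext (g := 0)) => a b.
    by rewrite tmapE (lin0 (tensA_linl _)).
  have r0 (t : tensorA (P r) (P (s + 1))) :
      tmap (bimod_comp u (bimod_id _)) (0 : bimodhom _ N) t = 0.
    apply: (tensorA_ext (g := 0)) => a b.
    by rewrite tmapE (lin0 (tensA_linr _)).
  by rewrite l0 r0 scaler0 addr0.
have sg (n : int) : (-1) ^ n != 0 :> k.
  by rewrite expfz_neq0 // oppr_eq0 oner_eq0.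
(* The scalar cancels the factor [- (-1) ^ (r + s - 1)] of [cobnd] and inserts the sign of the cup
   product. *)
exists (- (((-1) ^ (r + s - 1))^-1 * (-1) ^ (r * s)) *: w).
apply/bimodhom_eqP => x.
rewrite -[LHS]/((-1) ^ (r * s) *: cup_raw D (r + s) u v (th (r + s) x) -
  (-1) ^ (r * s) *:
    cup_raw Dhat (r + s) (bimod_comp u (th r)) (bimod_comp v (th s)) x).
rewrite -[RHS]/(- ((-1) ^ (r + s - 1) *:
  (- (((-1) ^ (r + s - 1))^-1 * (-1) ^ (r * s)) *:
    w (cdiff T (r + s) (r + s - 1) x)))).
by rewrite E scalerDr addrAC subrr add0r scaleNr scalerN opprK scalerA mulVKf.
Qed.

Lemma kappa_cap (M N : bimodType A) (r s : int)
    (u : hoch_cohomology T M r) (z : tate_homology T N s) :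
  cap D u (kappa_map z) = kappa_map (cap Dhat (iota_map u) z).
Proof.
have zu := hrepP u; have zz := hrepP z.
have /cocycleP du := zu.
have zk : bnd (s - 1) (tmapAe (th s) (hrep z)) = 0.
  by rewrite bnd_tmapAe zz (lin0 (tmapAe_linear _)).
have eu : ccls (hrep u) = u := hrepK u.
have ez : hhcls (hrep z) = z := hrepK z.
have ek : kappa_map z = hhcls (tmapAe (th s) (hrep z)) by [].
have ei : iota_map u = ccls (bimod_comp (hrep u) (th r)) by [].
have zu' := comp_cocycle (theta T) zu.
rewrite ek ei; have := cap_hhcls D zu zk; rewrite eu => ->.
have := cap_hhcls Dhat zu' zz; rewrite ez => ->.
rewrite /kappa_map homology_map_hhcls; last exact: cap_cycle.
move: (hrep u) (hrep z) zu zz du zk zu' {eu ez ek ei} => {}u {}z zu zz du zk zu'.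
have [h [h' hh']] := diagonal_homotopy s.
apply/hcls_eqP.
- exact: cap_cycle.
- rewrite -[LHS]/(bnd (s - r - 1) (tmapAe (th (s - r)) _)) bnd_tmapAe.
  by rewrite cap_cycle ?(lin0 (tmapAe_linear _)).
set p := s - r; pose tc := tcomp_hom P P s p r.
pose w := cap_eval u (tmapAe (tcomp_hom P P (s + 1) (p + 1) r) (tmapAe h z)).
suff E : cap_raw D p u (tmapAe (th s) z) =
    tmapAe (th p) (cap_raw Dhat p (bimod_comp u (th r)) z) + bnd p w.
  exists ((-1) ^ (r * p) *: w).
  rewrite /cap_chain -/p E scalerDr (linZ (tmapAe_linear _)).
  by rewrite addrAC subrr add0r linearZ.
rewrite cap_raw_eval tmapAe_comp -/tc.
have -> : bimod_comp (bimod_comp tc (D s)) (th s) =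
    bimod_comp tc (bimod_comp (ctensor_map th th s) (Dhat s)) +
    (bimod_comp (bimod_comp tc (cdiff Q (s + 1) s)) h +
     bimod_comp (bimod_comp tc h') (cdiff T s (s - 1))).
  apply/bimodhom_eqP => x; rewrite -[LHS]/(tcomp (D s (th s x)) p r) hh'.
  by rewrite 2!tcompD.
rewrite !tmapAeD !(linD (cap_eval_linear _)).
(* The [h'] term vanishes since [z] is a cycle, and the [h] term is the boundary of [w]. *)
rewrite -(tmapAe_comp (bimod_comp tc h')) -/(bnd (s - 1) z) zz.
rewrite (lin0 (tmapAe_linear _)) (lin0 (cap_eval_linear _)) addr0.
rewrite -(tmapAe_comp (bimod_comp tc _) h) cap_eval_diff //; congr (_ + _).
(* What is left is naturality: applying [theta (x) theta] and then evaluating [u] amounts to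
   evaluating [u theta] and then applying [theta]. *)
elim/tensor_ind: z {zz zk w} => [|x y z IH].
  rewrite !(lin0 (tmapAe_linear _)) (lin0 (cap_eval_linear _)).
  by rewrite (lin0 (@cap_raw_linear _ _ _ _ _ _ _ _ _ _)) (lin0 (tmapAe_linear _)).
rewrite !(linD (tmapAe_linear _)) (linD (cap_eval_linear _)).
rewrite (linD (@cap_raw_linear _ _ _ _ _ _ _ _ _ _)) (linD (tmapAe_linear _)) IH.
congr (_ + _); rewrite -!/(tensAe _ _) cap_rawE !tmapAeE cap_evalE.
rewrite -[bimod_comp tc _ _]/(tcomp (ctensor_map_obj th th s (Dhat s x)) p r) tcomp_ctensor_map.
elim/tensor_ind: (tcomp _ _ _) => [|a b t IHt].
  rewrite (lin0 (bimodhom_linear _)) !(lin0 (cap_pair_linear _ _)).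
  by rewrite (lin0 (tmapAe_linear _)).
rewrite (linD (bimodhom_linear _)) !(linD (cap_pair_linear _ _)).
rewrite (linD (tmapAe_linear _)) IHt; congr (_ + _).
by rewrite -!/(tensA _ _) tmapE !cap_pairE tmapAeE.
Qed.

End Comparison.

(** * Injectivity and bijectivity of the canonical maps *)

Section ThetaIso.
Variables (k : fieldType) (A : algType k) (T : complete_resolution A).
Variable (X : bimodType A).
Local Notation P := (trunc T).
Local Notation th := (theta T).

Lemma theta_inverse n : 0 <= n ->
  exists2 g : bimodhom (P n) (T n), cancel (th n) g & cancel g (th n).
Proof. by case: n => // n _; exists (bimod_id (T n)). Qed.

(** [theta] is invertible in degrees [n] and [n + 1], so a bounding chain in the truncation
    transports back to [T]. *)
Lemma kappa_inj n : 0 <= n -> injective (@kappa_map k A T X n).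
Proof.
move=> n0 z z'; have [g thK gK] := theta_inverse n0.
have [|g1 th1K g1K] := @theta_inverse (n + 1); first exact: addr_ge0.
have thz (y : tensorAe (T n) X) : bnd (n - 1) y = 0 ->
    bnd (n - 1) (tmapAe (th n) y) = 0.
  by move=> dy; rewrite bnd_tmapAe dy (lin0 (tmapAe_linear _)).
move=> /(hcls_eqP _ (thz _ (hrepP z)) (thz _ (hrepP z')))[w Ew].
rewrite -[z]hrepK -[z']hrepK.
apply/hcls_eqP; [exact: hrepP|exact: hrepP|exists (tmapAe g1 w)].
apply: (can_inj (tmapAe_cancel thK)).
by rewrite -bnd_tmapAe (tmapAe_cancel g1K) -[bnd n w]Ew linearB.
Qed.

(** Once [n - 1] is non-negative, cycles of the truncation are cycles of [T]; in degree 0 every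
    chain of the truncation is a cycle. *)
Lemma kappa_bij n : 0 < n -> bijective (@kappa_map k A T X n).
Proof.
move=> n0; have [g thK gK] := theta_inverse (ltW n0).
have [|g1 th1K g1K] := @theta_inverse (n - 1); first by lia.
pose f (z : hoch_homology T X n) : tate_homology T X n := hhcls (tmapAe g (hrep z)).
have fK : cancel f kappa_map.
  move=> z; rewrite /f /kappa_map homology_map_hhcls.
    by rewrite (tmapAe_cancel gK); apply: hrepK.
  apply: (can_inj (tmapAe_cancel th1K)).
  by rewrite -bnd_tmapAe (tmapAe_cancel gK) (hrepP z) (lin0 (tmapAe_linear _)).
by exists f => // z; apply: (kappa_inj (ltW n0)); rewrite fK.
Qed.

(** Cocycles involve degree [n + 1] and coboundaries degree [n - 1]; for [0 < n] the map [theta] is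
    invertible in all the degrees concerned. *)
Lemma iota_bij n : 0 < n -> bijective (@iota_map k A T X n).
Proof.
move=> n0; have [g thK gK] := theta_inverse (ltW n0).
have [|g1 th1K g1K] := @theta_inverse (n - 1); first by lia.
have [|g2 th2K g2K] := @theta_inverse (n + 1); first by lia.
pose f (u : tate_cohomology T X n) : hoch_cohomology T X n :=
  ccls (bimod_comp (hrep u) g).
have fK : cancel f iota_map.
  move=> u; rewrite /f /iota_map cohomology_map_ccls.
    rewrite (_ : bimod_comp _ _ = hrep u); first exact: hrepK.
    by apply/bimodhom_eqP => x /=; rewrite thK.
  apply/cocycleP => x; rewrite -[x]g2K -cmap_comm /= thK.
  by have /cocycleP -> := hrepP u.
have inj : injective (@iota_map k A T X n).
  move=> u u' /(hcls_eqP _ (comp_cocycle (theta T) (hrepP u))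
                           (comp_cocycle (theta T) (hrepP u')))[w Ew].
  rewrite -[u]hrepK -[u']hrepK.
  apply/hcls_eqP; [exact: hrepP|exact: hrepP|exists (bimod_comp w g1)].
  apply/bimodhom_eqP => x.
  have /bimodhom_eqP/(_ (g x)) := Ew.
  rewrite -[X in X = _ -> _]/(hrep u (th n (g x)) - hrep u' (th n (g x))) gK => E.
  rewrite -[LHS]/(hrep u x - hrep u' x) E.
  rewrite -[RHS]/(- ((-1) ^ (n - 1) *: w (g1 (cdiff P n (n - 1) x)))).
  by rewrite -[x in RHS]gK -cmap_comm th1K.
by exists f => // u; apply: inj; rewrite fK.
Qed.

End ThetaIso.

(** Identifications along [kappa_map] appear as equations between images, accompanied by the
    injectivity or bijectivity that justifies them. *)
Theorem proposition4p4 (k : fieldType) (A : falgType k) (hA : frobenius A)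
    (T : complete_resolution A)
    (Dhat : diagonal_approx (cr_eps T)) (D : diagonal_approx (trunc_eps T))
    (M N : bimodType A) (r s : int) :
  (* (1) *)
  (forall (u : hoch_cohomology T M r) (v : hoch_cohomology T N s),
     iota_map (cup D u v) = cup Dhat (iota_map u) (iota_map v)) /\
  (* (2)(a) *)
  (r = 0 -> s = 0 ->
     [/\ injective (@kappa_map k A T N s),
         injective (@kappa_map k A T (tensorA M N) (s - r)),
         forall (u : hoch_cohomology T M r) (z : tate_homology T N s),
           exists w : tate_homology T (tensorA M N) (s - r),
             cap D u (kappa_map z) = kappa_map w &
         forall (u : hoch_cohomology T M r) (z : tate_homology T N s),
           cap D u (kappa_map z) = kappa_map (cap Dhat (iota_map u) z)]) /\
  (* (2)(b) *)
  (r = 0 -> 0 < s ->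
     [/\ bijective (@kappa_map k A T N s),
         bijective (@kappa_map k A T (tensorA M N) (s - r)) &
         forall (u : hoch_cohomology T M r)
                (z : hoch_homology T N s) (z' : tate_homology T N s),
           kappa_map z' = z ->
           cap D u z = kappa_map (cap Dhat (iota_map u) z')]) /\
  (* (2)(c) *)
  (0 < r -> 0 < s -> r <= s ->
     [/\ bijective (@iota_map k A T M r),
         bijective (@kappa_map k A T N s) &
         forall (u : hoch_cohomology T M r)
                (z : hoch_homology T N s) (z' : tate_homology T N s),
           kappa_map z' = z ->
           cap D u z = kappa_map (cap Dhat (iota_map u) z')]).
Proof.
split; first exact: iota_cup.
split=> [r0 s0|].
  split; [by apply: kappa_inj; rewrite s0|by apply: kappa_inj; rewrite r0 s0| |].
    by move=> u z; exists (cap Dhat (iota_map u) z); apply: kappa_cap.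
  exact: kappa_cap.
split=> [r0 s0|r0 s0 _].
  split; [exact: kappa_bij|by apply: kappa_bij; rewrite r0 subr0|].
  by move=> u z z' <-; apply: kappa_cap.
split; [exact: iota_bij|exact: kappa_bij|].
by move=> u z z' <-; apply: kappa_cap.
Qed.
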